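(* Let $\mathbf{T}=(G,\mathcal{G},\mathcal{M},\mathcal{X},\simeq)$ be a decisive matroid tableau. Then $G$ is a gammoid if and only if there is a matroid $M\in\mathcal{G}$ such that $G\simeq M$.
   Context: Matroids are pairs $M=(E,\mathcal{I})$ with $E$ a finite ground set and $\mathcal{I}$ the system of independent sets; $\mathrm{rk}_M$ is the rank function. A matroid $N=(E',\mathcal{I}')$ is an extension of $M=(E,\mathcal{I})$ if $E\subseteq E'$ and $\mathcal{I}=\{X\in\mathcal{I}'\mid X\subseteq E\}$. A digraph is a pair $D=(V,A)$ with $V$ finite and $A\subseteq V\times V$. A path in $D$ is a non-empty, non-repeating sequence of vertices $p_1p_2\ldots p_n$ with $(p_i,p_{i+1})\in A$ for $1\le i<n$. A routing from $X$ to $Y$ in $D$ is a family $R$ of paths in $D$ such that every $x\in X$ is the first vertex of some $p\in R$, every $p\in R$ ends in a vertex of $Y$, and any two distinct paths of $R$ are vertex-disjoint. For $E,T\subseteq V$, $\Gamma(D,T,E)$ is the matroid on $E$ whose independent sets are those $X\subseteq E$ for which there is a routing from $X$ to $T$ in $D$. A matroid $(E,\mathcal{I})$ is a gammoid if it equals $\Gamma(D,T,E)$ for some digraph $D=(V,A)$ with $E\subseteq V$ and some $T\subseteq V$; it is a strict gammoid if such a representation exists with $V=E$. A matroid tableau is a tuple $\mathbf{T}=(G,\mathcal{G},\mathcal{M},\mathcal{X},\simeq)$ where $G$ is a matroid (the goal), $\mathcal{G},\mathcal{M},\mathcal{X}$ are families of matroids, and $\simeq$ is an equivalence relation on $\{G'\mid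 G'\text{ is a minor of }G\}\cup\mathcal{G}\cup\mathcal{M}\cup\mathcal{X}$. $\mathbf{T}$ is valid if (i) all matroids in $\mathcal{G}$ are gammoids, (ii) no matroid in $\mathcal{M}$ is a strict gammoid, (iii) no matroid in $\mathcal{X}$ is a gammoid, and (iv) every equivalence class of $\simeq$ either consists only of gammoids or contains no gammoid. $\mathbf{T}$, with goal $G=(E,\mathcal{I})$, is decisive if it is valid and at least one of the following holds: (i) there is $M\in\mathcal{G}$ with $G\simeq M$; (ii) there is $X\in\mathcal{X}$ that is isomorphic to a minor of $G$; (iii) for every extension $N=(E',\mathcal{I}')$ of $G$ with $|E'|=\mathrm{rk}_G(E)^2\cdot|E|+\mathrm{rk}_G(E)+|E|$ there is a matroid $M\in\mathcal{M}$ that is isomorphic to $N$. *)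

(* Defs.v *)
From HB Require Import structures.
From mathcomp Require Import all_boot finmap.

Set Implicit Arguments.
Unset Strict Implicit.
Unset Printing Implicit Defensive.

Local Open Scope fset_scope.

(* All elements of ground sets and all vertices of digraphs are drawn from one
   ambient type U. It has to be infinite so that fresh elements are always
   available: over a finite U, clause (iii) of [decisive] below could hold
   vacuously, and gammoids could lack room for a representing digraph. *)
Definition infinite_universe (U : choiceType) : Prop :=
  forall A : {fset U}, exists x, x \notin A.

Section Matroids.
Variable U : choiceType.
Implicit Types (X Y E : {fset U}) (I : {fset {fset U}}).

Definition matroid_axioms E I : bool :=
  [&& I `<=` fpowerset E,
      fset0 \in I,
      [forall X : I, [forall Y : fpowerset (val X), val Y \in I]] &
      [forall X : I, [forall Y : I, (#|` val X| < #|` val Y|) ==>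
         [exists y : val Y `\` val X, (val y |` val X) \in I]]]].

(* The axioms are boolean, so that two matroids with the same ground set and
   the same independent sets are equal (see [matroid_inj]). *)
Record matroid := Matroid {
  ground : {fset U};
  indep : {fset {fset U}};
  _ : matroid_axioms ground indep
}.

Lemma matroid_axiomsP E I :
  reflect
    [/\ forall X, X \in I -> X `<=` E,
        fset0 \in I,
        forall X Y, X \in I -> Y `<=` X -> Y \in I &
        forall X Y, X \in I -> Y \in I -> #|` X| < #|` Y| ->
          exists y, [/\ y \in Y, y \notin X & (y |` X) \in I]]
    (matroid_axioms E I).
Proof.
apply: (iffP and4P) => -[sIE I0 downI augI]; split=> //.
- by move=> X /(fsubsetP sIE); rewrite fpowersetE.
- move=> X Y XI sYX; have YpX : Y \in fpowerset X by rewrite fpowersetE.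
  exact: (forallP (forallP downI [` XI]) [` YpX]).
- move=> X Y XI YI ltXY.
  have := forallP (forallP augI [` XI]) [` YI].
  rewrite /= ltXY /= => /existsP[[y /= yYX] yXI].
  by move: (yYX); rewrite in_fsetD => /andP[yX yY]; exists y.
- by apply/fsubsetP=> X /sIE; rewrite fpowersetE.
- apply/forallP=> -[X XI]; apply/forallP=> -[Y YX] /=.
  by apply: (downI X) => //; rewrite -fpowersetE.
- apply/forallP=> -[X XI]; apply/forallP=> -[Y YI]; apply/implyP=> /= ltXY.
  have [y [yY yX yXI]] := augI X Y XI YI ltXY.
  have yYX : y \in Y `\` X by rewrite in_fsetD yX.
  by apply/existsP; exists [` yYX].
Qed.

Lemma matroidP (M : matroid) : matroid_axioms (ground M) (indep M).
Proof. by case: M. Qed.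

Lemma matroid_inj (M N : matroid) :
  ground M = ground N -> indep M = indep N -> M = N.
Proof.
case: M N => [E I axM] [E' I' axN] /= eqE eqI.
case: E' / eqE axN => axN; case: I' / eqI axN => axN.
by rewrite (bool_irrelevance axM axN).
Qed.

Implicit Types (M N : matroid).

Definition rk M X : nat := \max_(Y <- indep M | Y `<=` X) #|` Y|.

Definition is_basis_of M X B : Prop :=
  [/\ B \in indep M, B `<=` X &
      forall B', B' \in indep M -> B' `<=` X -> B `<=` B' -> B' = B].

Definition is_extension N M : Prop :=
  ground M `<=` ground N /\
  forall X, X \in indep M <-> X \in indep N /\ X `<=` ground M.

(* [N] is [(M / C) | ground N]: X is independent in M / C iff X `|` B is
   independent in M for a basis B of C. *)
Definition is_minor N M : Prop :=
  exists C, [/\ C `<=` ground M, ground N `<=` ground M `\` C &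
    forall X, X \in indep N <->
      X `<=` ground N /\ exists B, is_basis_of M C B /\ (X `|` B) \in indep M].

(* A bijection between the ground sets is given by a function on U, of which
   only the restriction to [ground M] matters. *)
Definition isomorphic M N : Prop :=
  exists f : U -> U,
    [/\ {in ground M &, injective f},
        f @` ground M = ground N &
        forall X, X `<=` ground M -> (X \in indep M <-> f @` X \in indep N)].

Record digraph := Digraph {
  vertices : {fset U};
  arcs : {fset U * U};
  arcs_sub : arcs `<=` vertices `*` vertices
}.
Implicit Types (D : digraph) (T : {fset U}).

Definition is_path D (p : seq U) : Prop :=
  [/\ p != [::], {subset p <= vertices D}, uniq p &
      sorted (fun u v => (u, v) \in arcs D) p].

Definition is_routing D X Y (R : {fset seq U}) : Prop :=
  [/\ forall p, p \in R -> is_path D p,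
      forall x, x \in X -> exists p, p \in R /\ exists q, p = x :: q,
      forall p, p \in R -> exists y, y \in Y /\ exists q, p = rcons q y &
      forall p q, p \in R -> q \in R -> p <> q ->
        forall x, x \in p -> x \notin q].

(* [M] is the matroid Gamma(D, T, ground M). *)
Definition represents D T M : Prop :=
  [/\ ground M `<=` vertices D, T `<=` vertices D &
      forall X, X \in indep M <->
        X `<=` ground M /\ exists R, is_routing D X T R].

Definition gammoid M : Prop := exists D T, represents D T M.

Definition strict_gammoid M : Prop :=
  exists D T, represents D T M /\ vertices D = ground M.

(* The three families are [tG], [tM], [tX]; they need not be finite. *)
Record tableau := Tableau {
  goal : matroid;
  tG : matroid -> Prop;
  tM : matroid -> Prop;
  tX : matroid -> Prop;
  teq : matroid -> matroid -> Prop;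
  tdom := fun M => is_minor M goal \/ tG M \/ tM M \/ tX M;
  teq_dom : forall M N, teq M N -> tdom M /\ tdom N;
  teq_refl : forall M, tdom M -> teq M M;
  teq_sym : forall M N, teq M N -> teq N M;
  teq_trans : forall M N P, teq M N -> teq N P -> teq M P
}.
Implicit Types (t : tableau).

Definition valid t : Prop :=
  [/\ forall M, tG t M -> gammoid M,
      forall M, tM t M -> ~ strict_gammoid M,
      forall M, tX t M -> ~ gammoid M &
      forall M, tdom t M ->
        (forall N, teq t M N -> gammoid N) \/
        (forall N, teq t M N -> ~ gammoid N)].

Definition decisive t : Prop :=
  let G := goal t in
  let E := ground G in
  valid t /\
  [\/ exists M, tG t M /\ teq t G M,
      exists M N, [/\ tX t M, is_minor N G & isomorphic M N] |
      forall N, is_extension N G ->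
        #|` ground N| = (rk G E ^ 2 * #|` E| + rk G E + #|` E|)%N ->
        exists M, tM t M /\ isomorphic M N].

End Matroids.

(* Main.v *)
Require Import Defs.
From mathcomp Require Import all_boot finmap.
From mathcomp Require Import ssralg ssrnum poly matrix mxalgebra rat fingroup perm zmodp.
From mathcomp Require Import zify.

(* The point is that a gammoid G of rank r on n elements extends
   to a strict gammoid with r^2 n + r + n elements; this is the cut covering
   argument of Kratsch and Wahlstroem, carried out with Hall's condition in place
   of paths. A set X is linked to the targets iff the non-targets L have an
   injection u |-> s u outside X with s u = u or u -> s u an arc, i.e. iff
   |X| + |S| <= |X + N(S)| (a union) for all S in L, where N is the closed
   out-neighbourhood. A generic matrix supported on N represents the gammoid over
   the rationals: the rank of X is the minimum of |X + N(S)| - |S|.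
   A minimum cut between E and the targets can replace the targets, so that there
   are r of them. A vertex v outside E can be bypassed unless, for some A in E,
   every S attaining the rank of A has v in N(S) \ S. Let P be the closure of A
   and S the set of u with N(u) in P. Then v has an out-neighbour b outside P and an
   in-neighbour c outside the closure of the complement of S in the reversed
   gammoid with targets E, while P \ S is independent and contains v. Tensoring
   the vectors of c, b and v separates the vertices that cannot be bypassed, hence
   there are at most n * r * r of them.
   Contracting a basis B in the dual transversal presentation deletes B from the
   columns, which shows that minors of gammoids are gammoids. *)

Set Implicit Arguments.
Unset Strict Implicit.
Unset Printing Implicit Defensive.

(** * Generic matrices supported on a relation *)

(* Elaborating [{set 'I_m}] leaves [reverse_coercion]s and canonical projections
   in cardinals, which [lia] would read as different atoms; it would also compare
   ranks with cardinals by conversion, and process memberships and inclusions. *)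
Ltac card_lia :=
  unfold reverse_coercion in *; simpl Finite.sort in *;
  simpl Algebra.BaseAddUMagma.sort in *;
  repeat match goal with H : is_true ?b |- _ =>
    lazymatch b with leq _ _ => fail | _ => clear H end
  end;
  repeat match goal with
  | |- context [@mxrank.body ?F ?m ?n ?A] =>
    let x := fresh "x" in set (x := @mxrank.body F m n A) in *; clearbody x
  | |- context [@card.body ?T ?p] =>
    let x := fresh "x" in set (x := @card.body T p) in *; clearbody x
  | H : context [@mxrank.body ?F ?m ?n ?A] |- _ =>
    let x := fresh "x" in set (x := @mxrank.body F m n A) in *; clearbody x
  | H : context [@card.body ?T ?p] |- _ =>
    let x := fresh "x" in set (x := @card.body T p) in *; clearbody x
  end; lia.

Lemma leq_cards (T : finType) (A B : {set T}) : A \subset B -> #|A| <= #|B|.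
Proof. exact: subset_leq_card. Qed.

Section RatPoly.
Import GRing.Theory Num.Theory.
Local Open Scope ring_scope.

Lemma rat_poly_nonroot (p : {poly rat}) : p != 0 -> exists t, p.[t] != 0.
Proof.
move=> p0; pose s := [seq (i%:R : rat) | i <- iota 0 (size p)].
have us : uniq s by rewrite map_inj_uniq ?iota_uniq // => i j /eqP; rewrite eqr_nat => /eqP.
case: (boolP (all (root p) s)) => [rs|/allPn[t _ rt]]; last by exists t.
by have := max_poly_roots p0 rs us; rewrite size_map size_iota ltnn.
Qed.

End RatPoly.

Section Masks.
Import GRing.Theory.
Local Open Scope ring_scope.
Variables (F : fieldType) (m : nat).
Implicit Types (X Y Z : {set 'I_m}).

Definition cmask X : 'M[F]_m := diag_mx (\row_j (j \in X)%:R).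

Lemma mul_cmaskE p (A : 'M[F]_(p, m)) X i j :
  (A *m cmask X) i j = A i j *+ (j \in X).
Proof. by rewrite mul_mx_diag !mxE mulr_natr. Qed.

Lemma cmask_mulE p X (A : 'M[F]_(m, p)) i j :
  (cmask X *m A) i j = A i j *+ (i \in X).
Proof. by rewrite mul_diag_mx !mxE mulr_natl. Qed.

Lemma row_cmask_mul p X (A : 'M[F]_(m, p)) i :
  row i (cmask X *m A) = row i A *+ (i \in X).
Proof. by apply/rowP=> j; rewrite mxE cmask_mulE; case: (i \in X); rewrite !mxE. Qed.

Lemma cmaskM X Y : cmask X *m cmask Y = cmask (X :&: Y).
Proof.
apply/matrixP=> i j; rewrite mul_cmaskE !mxE inE.
by case: eqP => [->|_]; case: (_ \in X); case: (_ \in Y);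
  rewrite ?mulr1n ?mulr0n ?mul0rn.
Qed.

Lemma cmaskC X : cmask X + cmask (~: X) = 1%:M :> 'M[F]_m.
Proof.
apply/matrixP=> i j; rewrite !mxE !inE.
by case: eqP => [->|_]; case: (_ \in X); rewrite ?mulr1n ?mulr0n ?addr0 ?add0r.
Qed.

Lemma cmask_sub p q X (A : 'M[F]_(m, p)) (B : 'M[F]_(q, p)) :
  reflect (forall i, i \in X -> (row i A <= B)%MS) (cmask X *m A <= B)%MS.
Proof.
apply: (iffP row_subP) => [sXB i iX|sXB i].
  by have := sXB i; rewrite row_cmask_mul iX.
rewrite row_cmask_mul; case: (boolP (i \in X)) => [/sXB //|_].
by rewrite mulr0n sub0mx.
Qed.

Lemma rank_cmask X : \rank (cmask X) = #|X|.
Proof.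
have leX Y : (\rank (cmask Y) <= #|Y|)%N.
  have -> : cmask Y = \sum_(i in Y) delta_mx i i.
    apply/matrixP=> i j; rewrite summxE !mxE.
    case: (boolP (i \in Y)) => iY.
      rewrite (bigD1 i) //= big1 ?addr0 => [|k /andP[_ /negPf ki]].
        by rewrite mxE eqxx (eq_sym j); case: eqP => //= ->; rewrite iY.
      by rewrite mxE eq_sym ki.
    rewrite big1 => [|k kY]; last first.
      by rewrite mxE; case: eqP => // ik; rewrite ik kY in iY.
    by case: eqP => //= <-; rewrite (negPf iY).
  apply: leq_trans (_ : (\sum_(i in Y) 1 <= _)%N); last by rewrite sum1_card.
  elim/big_rec2: _ => [|i a b _ le_ab]; first by rewrite mxrank0.
  by rewrite (leq_trans (mxrank_add _ _)) // mxrank_delta leq_add2l.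
apply/eqP; rewrite eqn_leq leX /=.
have := leq_trans (mxrank_add (cmask X) (cmask (~: X))).
rewrite cmaskC mxrank1 => /(_ _ (leq_add (leqnn _) (leX (~: X)))).
by have := cardsC X; rewrite card_ord => {1}<-; rewrite leq_add2r.
Qed.

Lemma sub_cmask p (A : 'M[F]_(p, m)) X :
  (A <= cmask X)%MS = (A *m cmask (~: X) == 0).
Proof.
apply/idP/eqP => [/submxP[B ->]|A0].
  by rewrite -mulmxA cmaskM setICr; apply/matrixP=> i j; rewrite mul_cmaskE inE mxE.
have -> : A = A *m cmask X by rewrite -[LHS]mulmx1 -(cmaskC X) mulmxDr A0 addr0.
exact: submxMl.
Qed.

End Masks.

Arguments cmask {F m} X.

Section Generic.
Import GRing.Theory Num.Theory.
Local Open Scope ring_scope.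
Variables (F : fieldType) (m : nat) (Nb : 'I_m -> {set 'I_m}).
Hypothesis poly_nonroot : forall p : {poly F}, p != 0 -> exists t, p.[t] != 0.
Implicit Types (S L X Y : {set 'I_m}).

Definition nbs S := \bigcup_(u in S) Nb u.

Lemma nbsP S x : reflect (exists2 u, u \in S & x \in Nb u) (x \in nbs S).
Proof. exact: bigcupP. Qed.

Lemma nbs_subP S X :
  reflect (forall u, u \in S -> Nb u \subset X) (nbs S \subset X).
Proof. exact: bigcupsP. Qed.

Lemma nbsU1 u S : nbs (u |: S) = Nb u :|: nbs S.
Proof. by rewrite /nbs bigcup_setU big_set1. Qed.

Lemma nbsU S S' : nbs (S :|: S') = nbs S :|: nbs S'.
Proof. exact: bigcup_setU. Qed.

Lemma nbsS S S' : S \subset S' -> nbs S \subset nbs S'.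
Proof. by move=> /setUidPr <-; rewrite nbsU subsetUl. Qed.

(* The moment vector [t ^+ j], for [t] off the roots of finitely many
   polynomials, is in general position. *)
Lemma generic_vector (N : {set 'I_m}) (B : {set 'I_m} -> 'M[F]_m) :
  exists w : 'rV[F]_m, (w <= cmask N)%MS /\
    forall Y, (w *m cmask Y <= B Y)%MS -> (cmask (N :&: Y) <= B Y)%MS.
Proof.
pose bad Y := ~~ (cmask (N :&: Y) <= B Y)%MS.
(* The value of [pl Y k] at [t] is entry [k] of the masked moment vector times the cokernel of
   [B Y], so it tests membership in the row space of [B Y]. *)
pose pl Y (k : 'I_m) : {poly F} :=
  \sum_(j in N :&: Y) (cokermx (B Y) j k) *: 'X^j.
have plE Y k (i : 'I_m) : (pl Y k)`_i = cokermx (B Y) i k *+ (i \in N :&: Y).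
  rewrite coef_sum (eq_bigr (fun j : 'I_m => if j == i then cokermx (B Y) i k else 0)).
    case: (boolP (i \in N :&: Y)) => iN; last first.
      by rewrite big1 // => j jN; case: eqP => // ji; rewrite -ji jN in iN.
    rewrite (bigD1 i) //= eqxx big1 ?addr0 ?mulr1n // => j /andP[_ /negPf ji].
    by rewrite ji.
  move=> j _; rewrite coefZ coefXn eq_sym val_eqE.
  by case: eqP => [->|_]; rewrite ?mulr1 ?mulr0.
have badP Y : bad Y -> exists k, pl Y k != 0.
  rewrite /bad submxE => /eqP NB; apply/existsP; apply: contra_notT NB.
  rewrite negb_exists => /forallP p0; apply/matrixP=> i k.
  have /eqP/polyP/(_ (i : nat)) := negbNE (p0 k).
  by rewrite plE coef0 cmask_mulE => ->; rewrite mxE.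
(* One nonzero polynomial is chosen for each bad [Y], and the constant 1 for the others, so that a
   single [t] off the roots of the product serves all [Y]. *)
pose q Y := if [pick k | pl Y k != 0] is Some k then pl Y k else 1.
have q0 Y : q Y != 0 by rewrite /q; case: pickP => // _; exact: oner_neq0.
have [|t /= rt] := poly_nonroot (p := \prod_Y q Y).
  by apply/prodf_neq0.
exists (\row_j (t ^+ j *+ (j \in N))); split.
  rewrite sub_cmask; apply/eqP/rowP=> j; rewrite mul_cmaskE !mxE !inE.
  by case: (j \in N); rewrite ?mulr0n ?mul0rn.
move=> Y wB; apply: contraTT wB => badY.
have qt : (q Y).[t] != 0.
  apply: contraNneq rt => qt.
  by rewrite horner_prod (bigD1 Y) //= qt mul0r.
move: qt; rewrite /q; case: pickP => [k _|p0]; last first.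
  by have [k] := badP _ badY; rewrite p0.
rewrite submxE; apply: contra => /eqP/rowP/(_ k); rewrite [RHS]mxE => <-.
rewrite mxE /pl horner_sum big_mkcond /=; apply/eqP/eq_bigr=> j _.
rewrite mul_cmaskE !mxE hornerZ hornerXn inE mulrC.
by case: (j \in N); case: (j \in Y); rewrite ?mulr1n ?mulr0n ?mulr0 ?mul0r.
Qed.

(** This is the min-max formula for the term rank, by adding generic rows one at a time. If the new
    row is independent of the old ones on the columns [Y], the rank grows and the old [S] still
    works. Otherwise genericity puts all unit vectors of [Z = Nb l :&: Y] in the old row space. They
    account for [#|Z|] of the rank, the induction hypothesis for [Y :\: Z] accounts for the rest,
    and [l] joins [S]. *)
Lemma generic_matrix L :
  exists W : 'M[F]_m,
    (forall i j, W i j != 0 -> i \in L /\ j \in Nb i) /\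
    forall Y, exists2 S : {set 'I_m}, S \subset L &
      (#|L| + #|nbs S :&: Y| <= \rank (W *m cmask Y) + #|S|)%N.
Proof.
have [n] := ubnP #|L|; elim: n L => // n IHn L; rewrite ltnS => ltLn.
have [->|[l lL]] := set_0Vmem L.
  exists 0; split=> [i j|Y]; first by rewrite mxE eqxx.
  by exists set0; rewrite ?sub0set // /nbs big_set0 set0I !cards0.
have cL : #|L| = #|L :\ l|.+1 by rewrite (cardsD1 l L) lL.
have [|W0 [W0s W0r]] := IHn (L :\ l); first by rewrite -ltnS -cL.
have [w [ws wr]] := @generic_vector (Nb l) (fun Y => W0 *m cmask Y).
have W0l j : W0 l j = 0.
  by apply/eqP; apply: contraT => /W0s[]; rewrite !inE eqxx.
pose W := \matrix_(i, j) if i == l then w 0 j else W0 i j.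
have rowW i : row i W = if i == l then w else row i W0.
  by apply/rowP=> j; rewrite !mxE; case: eqP; rewrite ?mxE.
have sW0 Y : (W0 *m cmask Y <= W *m cmask Y)%MS.
  apply/row_subP=> i; rewrite row_mul; case: (eqVneq i l) => [->|il].
    suff -> : row l W0 = 0 by rewrite mul0mx sub0mx.
    by apply/rowP=> j; rewrite !mxE.
  by have := rowW i; rewrite (negPf il) => <-; rewrite -row_mul row_sub.
exists W; split=> [i j|Y].
  rewrite mxE; case: (eqVneq i l) => [-> wj|_ /W0s[]]; last by rewrite inE => /andP[].
  split=> //; move: ws; rewrite sub_cmask => /eqP/rowP/(_ j).
  rewrite mul_cmaskE [RHS]mxE inE; case: (j \in Nb l) => //= /eqP.
  by rewrite (negPf wj).
case: (boolP (w *m cmask Y <= W0 *m cmask Y)%MS) => [/wr sZ|wY].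
  set Z := Nb l :&: Y in sZ.
  have [S sS leS] := W0r (Y :\: Z); exists (l |: S).
    by rewrite subUset sub1set lL (subset_trans sS) ?subsetDl.
  have lS : l \notin S by apply: contraTN sS => lS; apply/subsetPn; exists l; rewrite ?inE ?eqxx.
  have -> : nbs (l |: S) :&: Y = Z :|: (nbs S :&: (Y :\: Z)).
    apply/setP=> x; rewrite nbsU1 !inE.
    by case: (x \in Nb l); case: (x \in nbs S); case: (x \in Y).
  rewrite cardsU1 lS cL.
  have dZ : [disjoint Z & nbs S :&: (Y :\: Z)].
    by rewrite -setI_eq0; apply/eqP/setP=> x; rewrite !inE;
       case: (x \in Nb l); case: (x \in Y); rewrite ?andbF.
  rewrite cardsU; move: dZ; rewrite -setI_eq0 => /eqP ->; rewrite cards0 subn0.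
  suff : (#|Z| + \rank (W0 *m cmask (Y :\: Z)) <= \rank (W *m cmask Y))%N by card_lia.
  apply: leq_trans (mxrankS (sW0 Y)).
  rewrite -(rank_cmask F Z) -mxrank_disjoint_sum.
    apply: mxrankS; rewrite addsmx_sub sZ /=.
    have -> : W0 *m cmask (Y :\: Z) = W0 *m cmask Y - W0 *m cmask Z.
      apply/matrixP=> i j; rewrite mul_cmaskE [RHS]mxE [X in _ + X]mxE !mul_cmaskE !inE.
      by case: (j \in Nb l); case: (j \in Y); rewrite ?subrr ?subr0.
    apply: addmx_sub => //; rewrite -scaleN1r scalemx_sub //.
    exact: submx_trans (submxMl _ _) sZ.
  apply/eqP; rewrite -submx0; apply/rV_subP=> x; rewrite sub_capmx => /andP[].
  rewrite !sub_cmask => /eqP xZ /submxP[a xa].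
  have -> : x = x *m cmask Z by rewrite -[LHS]mulmx1 -(cmaskC F Z) mulmxDr xZ addr0.
  rewrite xa -!mulmxA cmaskM; have -> : (Y :\: Z) :&: Z = set0.
    by apply/setP=> y; rewrite !inE; case: (y \in Nb l); case: (y \in Y).
  by rewrite submx0; apply/eqP/matrixP=> i j; rewrite mulmxA mul_cmaskE inE [RHS]mxE.
have [S sS leS] := W0r Y; exists S; first exact: subset_trans sS (subsetDl _ _).
rewrite cL; suff : (\rank (W0 *m cmask Y) < \rank (W *m cmask Y))%N by card_lia.
have : (W0 *m cmask Y < W *m cmask Y)%MS.
  rewrite ltmxE sW0; apply: contra wY; apply: submx_trans.
  by have := rowW l; rewrite eqxx => <-; rewrite -row_mul row_sub.
by rewrite ltmxErank => /andP[].
Qed.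

End Generic.

(** * Linear representation of gammoids *)

Section RowMatroid.
Import GRing.Theory.
Local Open Scope ring_scope.
Variables (F : fieldType) (m r : nat) (H : 'M[F]_(m, r)).
Implicit Types (X Y : {set 'I_m}) (u : 'I_m).

Definition row_rank X := \rank (cmask X *m H).
Definition row_closure X := [set u | (row u H <= cmask X *m H)%MS].

Lemma cmask_mul_submx X Y : X \subset Y -> (cmask X *m H <= cmask Y *m H)%MS.
Proof.
move=> /subsetP sXY; apply/cmask_sub=> i /sXY iY.
by move/cmask_sub: (submx_refl (cmask Y *m H)); apply.
Qed.

Lemma row_rankS X Y : X \subset Y -> (row_rank X <= row_rank Y)%N.
Proof. by move/cmask_mul_submx/mxrankS. Qed.

Lemma row_rank_leq_card X : (row_rank X <= #|X|)%N.
Proof. by rewrite -(rank_cmask F X) mxrankM_maxl. Qed.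

Lemma sub_row_closure X : X \subset row_closure X.
Proof.
apply/subsetP=> u uX; rewrite inE.
by move/cmask_sub: (submx_refl (cmask X *m H)); apply.
Qed.

Lemma row_rank_closure X : row_rank (row_closure X) = row_rank X.
Proof.
apply/eqP; rewrite eqn_leq [X in _ && X]row_rankS ?sub_row_closure // andbT.
by apply/mxrankS/cmask_sub=> i; rewrite inE.
Qed.

Lemma sub_closure_rank X Y :
  X \subset Y -> (row_rank Y <= row_rank X)%N -> Y \subset row_closure X.
Proof.
move=> sXY leYX; apply/subsetP=> u uY; rewrite inE.
have sYX : (cmask Y *m H <= cmask X *m H)%MS.
  by rewrite -(mxrank_leqif_sup (cmask_mul_submx sXY)) eqn_leq leYX row_rankS.
by move/cmask_sub: sYX; apply.
Qed.

Lemma row_rankU1 u X : u \notin row_closure X -> (row_rank X < row_rank (u |: X))%N.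
Proof.
rewrite ltnNge; apply: contra => /(sub_closure_rank (subsetUr _ _)).
by move/subsetP; apply; rewrite setU11.
Qed.

Lemma row_basis X :
  exists B : {set 'I_m}, [/\ B \subset X, row_rank B = #|B| & row_rank B = row_rank X].
Proof.
pose P (B : {set 'I_m}) := (B \subset X) && (row_rank B == #|B|).
have P0 : P set0.
  by rewrite /P sub0set /= cards0 -leqn0 -(cards0 'I_m) row_rank_leq_card.
have [B /maxsetP[/andP[sBX /eqP rB] maxB] _] := maxset_exists P0.
exists B; split=> //; apply/eqP; rewrite eqn_leq row_rankS //=.
rewrite -(row_rank_closure B); apply: row_rankS; apply/subsetP=> u uX.
apply: contraT => uB; have uBn : u \notin B by apply: contra uB; apply/subsetP/sub_row_closure.
have := maxB (u |: B); rewrite subsetUr => /(_ _ isT) BuB.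
have : u \in B.
  rewrite -BuB ?setU11 // /P subUset sub1set uX sBX /=.
  rewrite eqn_leq row_rank_leq_card cardsU1 uBn add1n -rB.
  exact: row_rankU1.
by rewrite (negPf uBn).
Qed.

(** Some column of the cokernel detects [u]. These columns are the functionals fed to the tensor
    bound. *)
Lemma row_separation u X : u \notin row_closure X ->
  exists y : 'cV[F]_r, (forall i, i \in row_closure X -> row i H *m y = 0) /\ row u H *m y != 0.
Proof.
rewrite inE submxE => nz.
have [k yk] : exists k, (row u H *m cokermx (cmask X *m H)) ord0 k != 0.
  apply/existsP; apply: contraNT nz; rewrite negb_exists => /forallP y0.
  by apply/eqP/rowP=> k; rewrite [RHS]mxE; apply/eqP/negbNE/y0.
exists (col k (cokermx (cmask X *m H))); rewrite colE; split=> [i iX|].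
  by move: iX; rewrite inE submxE => /eqP iX0; rewrite mulmxA iX0 mul0mx.
by apply: contra yk; rewrite mulmxA -colE => /eqP/matrixP/(_ ord0 ord0);
   rewrite mxE => ->; rewrite mxE.
Qed.

End RowMatroid.

Ltac rank_lia :=
  unfold reverse_coercion in *;
  repeat match goal with
  | |- context [@row_rank ?F ?m ?r ?H ?A] =>
    let x := fresh "x" in set (x := @row_rank F m r H A) in *; clearbody x
  | H : context [@row_rank ?F ?m ?r ?H' ?A] |- _ =>
    let x := fresh "x" in set (x := @row_rank F m r H' A) in *; clearbody x
  end; card_lia.

Section Representation.
Import GRing.Theory.
Local Open Scope ring_scope.
Variables (F : fieldType) (m : nat) (Nb : 'I_m -> {set 'I_m}) (L : {set 'I_m}).
Hypothesis poly_nonroot : forall p : {poly F}, p != 0%R -> exists t, p.[t] != 0%R.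
Hypothesis diag : {in L, forall u, u \in Nb u}.
Implicit Types (S X Y : {set 'I_m}).

Lemma sub_nbs S : S \subset L -> S \subset nbs Nb S.
Proof. by move=> /subsetP sSL; apply/subsetP=> u uS; apply/nbsP; exists u; rewrite ?diag ?sSL. Qed.

(** The columns of a generic [W] represent the transversal matroid of the sets [Nb u], [u \in L],
    and the rows of its cokernel represent the dual. Passing to [col_base] leaves exactly as many
    columns as the rank, which gives the bound on [r]. *)
Lemma nbs_representation :
  exists r (H : 'M[F]_(m, r)),
    [/\ (r + #|L| <= m)%N,
        forall X, exists2 S : {set 'I_m}, S \subset L &
          (#|X :|: nbs Nb S| <= row_rank H X + #|S|)%N &
        forall X S, S \subset L -> nbs Nb S \subset X ->
          (row_rank H X + #|S| <= #|X|)%N].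
Proof.
have [W [Ws Wr]] := generic_matrix Nb poly_nonroot L.
have supp S Y : S \subset L -> nbs Nb S \subset Y ->
    (\rank (W *m cmask (~: Y)) <= #|L :\: S|)%N.
  move=> sSL /nbs_subP sSY.
  have -> : W *m cmask (~: Y) = cmask (L :\: S) *m (W *m cmask (~: Y)).
    apply/matrixP=> i j; rewrite cmask_mulE mul_cmaskE !inE.
    case: (eqVneq (W i j) 0) => [->|/Ws[iL jNi]]; first by rewrite !mul0rn.
    rewrite iL andbT; case: (boolP (i \in S)) => //= iS.
    by rewrite (subsetP (sSY i iS)).
  by rewrite -(rank_cmask F (L :\: S)) mxrankM_maxl.
(* By [diag] every [S] satisfies [#|S| <= #|nbs Nb S|], so the min-max formula with all columns
   gives at least [#|L|]. *)
have WL : \rank W = #|L|.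
  apply/eqP; rewrite eqn_leq; apply/andP; split.
    have := @supp set0 set0 (sub0set _); rewrite /nbs big_set0 sub0set => /(_ isT).
    rewrite setD0; suff -> : W *m cmask (~: set0) = W by [].
    by apply/matrixP=> i j; rewrite mul_cmaskE !inE.
  have [S sS leS] := Wr setT; have := leq_cards (sub_nbs sS).
  have := mxrankM_maxl W (cmask setT); move: leS; rewrite setIT; card_lia.
(* The rank formula of the dual matroid. Rank-nullity is used twice: the vectors supported on [X]
   that the cokernel kills are the vectors of the row space of [W] that vanish outside [X]. *)
have rankE X :
    (\rank (cmask X *m cokermx W) + #|L| = #|X| + \rank (W *m cmask (~: X)))%N.
  have := mxrank_mul_ker (cmask X) (cokermx W).
  have := mxrank_mul_ker W (cmask (~: X)); rewrite rank_cmask WL.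
  suff -> : \rank (cmask X :&: kermx (cokermx W))%MS =
      \rank (W :&: kermx (cmask (~: X)))%MS by card_lia.
  apply: eqmx_rank.
  have capE p (A : 'M_(p, m)) : (A <= cmask X :&: kermx (cokermx W))%MS =
      (A <= W :&: kermx (cmask (~: X)))%MS.
    by rewrite !sub_capmx !sub_kermx sub_cmask -submxE andbC.
  by rewrite -capE submx_refl capE submx_refl.
exists (\rank (cokermx W)), (col_base (cokermx W)).
have rk X : row_rank (col_base (cokermx W)) X = \rank (cmask X *m cokermx W).
  by rewrite -[in RHS](mulmx_base (cokermx W)) mulmxA mxrankMfree ?row_base_free.
split=> [|X|X S sSL sSX].
- by rewrite mxrank_coker WL subnK // -[X in (_ <= X)%N]card_ord max_card.
- have [S sS leS] := Wr (~: X); exists S; rewrite // rk.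
  have := rankE X; rewrite cardsU; have := cardsID X (nbs Nb S).
  rewrite setDE [X :&: _]setIC; card_lia.
- rewrite rk; have := rankE X; have := supp _ _ sSL sSX.
  by have := cardsID S L; rewrite (setIidPr sSL); card_lia.
Qed.

End Representation.

(* Otherwise comparing two ranks runs Gaussian elimination symbolically. *)
#[global] Opaque row_rank.

(** * Vertices that cannot be bypassed *)

Section TripleTensor.
Import GRing.Theory.
Local Open Scope ring_scope.

(* The products [x1 u (x) x2 u (x) x3 u] are separated by the functionals
   [y1 v (x) y2 v (x) y3 v], hence independent in dimension [p * (q * s)]. *)
Lemma triple_tensor_bound (F : fieldType) (I : finType) (Z : {set I}) p q s
    (x1 : I -> 'rV[F]_p) (x2 : I -> 'rV[F]_q) (x3 : I -> 'rV[F]_s)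
    (y1 : I -> 'cV[F]_p) (y2 : I -> 'cV[F]_q) (y3 : I -> 'cV[F]_s) :
  (forall v, v \in Z -> [/\ x1 v *m y1 v != 0, x2 v *m y2 v != 0 & x3 v *m y3 v != 0]) ->
  (forall u v, u \in Z -> v \in Z -> u != v ->
     [\/ x1 u *m y1 v = 0, x2 u *m y2 v = 0 | x3 u *m y3 v = 0]) ->
  (#|Z| <= p * (q * s))%N.
Proof.
move=> diag offdiag.
pose T : finType := ('I_p * ('I_q * 'I_s))%type.
pose e (i : 'I_#|Z|) : I := enum_val i.
pose M := \matrix_(i < #|Z|, j < #|Z|)
  ((x1 (e i) *m y1 (e j)) 0 0 *
   ((x2 (e i) *m y2 (e j)) 0 0 * (x3 (e i) *m y3 (e j)) 0 0)).
pose A := \matrix_(i < #|Z|, t < #|T|)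
  (x1 (e i) 0 (enum_val t).1 *
   (x2 (e i) 0 (enum_val t).2.1 * x3 (e i) 0 (enum_val t).2.2)).
pose B := \matrix_(t < #|T|, j < #|Z|)
  (y1 (e j) (enum_val t).1 0 *
   (y2 (e j) (enum_val t).2.1 0 * y3 (e j) (enum_val t).2.2 0)).
have MAB : M = A *m B.
  apply/matrixP=> i j; rewrite !mxE.
  under [RHS]eq_bigr => t _ do rewrite !mxE.
  rewrite -(big_enum_val (A := T) (fun t : T =>
    (x1 (e i) 0 t.1 * (x2 (e i) 0 t.2.1 * x3 (e i) 0 t.2.2)) *
    (y1 (e j) t.1 0 * (y2 (e j) t.2.1 0 * y3 (e j) t.2.2 0)))) /=.
  rewrite big_distrlr big_distrlr /= -(pair_bigA _ (fun a bc =>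
    (x1 (e i) 0 a * (x2 (e i) 0 bc.1 * x3 (e i) 0 bc.2)) *
    (y1 (e j) a 0 * (y2 (e j) bc.1 0 * y3 (e j) bc.2 0)))) /=.
  apply: eq_bigr => a _; rewrite -(pair_bigA _ (fun b c =>
    (x1 (e i) 0 a * (x2 (e i) 0 b * x3 (e i) 0 c)) *
    (y1 (e j) a 0 * (y2 (e j) b 0 * y3 (e j) c 0)))) /=.
  apply: eq_bigr => b _; rewrite mulr_sumr; apply: eq_bigr => c _.
  by rewrite [RHS]mulrACA; congr (_ * _); rewrite mulrACA.
have cT : #|T| = (p * (q * s))%N by rewrite !card_prod !card_ord.
have z1 (R : 'M[F]_1) : (R 0 0 == 0) = (R == 0).
  apply/eqP/eqP => [R0|->]; last by rewrite mxE.
  by apply/matrixP=> i j; rewrite !ord1 R0 mxE.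
(* [M] is diagonal with nonzero diagonal entries, so its rank is [#|Z|], while it factors through
   dimension [#|T|]. *)
have Mu : M \in unitmx.
  have -> : M = diag_mx (\row_i M i i).
    apply/matrixP=> i j; rewrite [RHS]mxE; case: (eqVneq i j) => [->|ij].
      by rewrite mulr1n [RHS]mxE.
    rewrite mulr0n mxE; apply/eqP; rewrite !mulf_eq0 !z1.
    have [] := @offdiag (e i) (e j); rewrite ?enum_valP //; last 3 first.
    - by move=> ->; rewrite eqxx.
    - by move=> ->; rewrite eqxx orbT.
    - by move=> ->; rewrite eqxx !orbT.
    by rewrite (inj_eq enum_val_inj).
  rewrite unitmxE det_diag unitfE; apply/prodf_neq0=> i _.
  have [] := diag (e i) (enum_valP i).
  by rewrite !mxE -!z1 !mxE => a b c; rewrite !mulf_neq0.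
have := mxrank_unit Mu; rewrite MAB => rZ.
by rewrite -rZ -cT; apply: leq_trans (mxrankM_maxl _ _) (rank_leq_col _).
Qed.

End TripleTensor.

(** * Hall's condition, flats and essential vertices *)

Section Hall.
Variables (m : nat).
Implicit Types (S X Y L E : {set 'I_m}) (Nb : 'I_m -> {set 'I_m}).

Definition hall_indep Nb L X := [forall S : {set 'I_m},
  (S \subset L) ==> (#|X| + #|S| <= #|X :|: nbs Nb S|)].

Lemma hall_indepP Nb L X :
  reflect (forall S, S \subset L -> #|X| + #|S| <= #|X :|: nbs Nb S|)
          (hall_indep Nb L X).
Proof.
apply: (iffP forallP) => [h S sSL|h S]; first exact: (implyP (h S)).
by apply/implyP; apply: h.
Qed.

(* The gammoid on ['I_m] with non-targets [L] is represented by the rows of [H]. *)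
Definition nbs_represented (F : fieldType) r (H : 'M[F]_(m, r)) Nb L :=
  (forall X, exists2 S : {set 'I_m}, S \subset L &
     #|X :|: nbs Nb S| <= row_rank H X + #|S|) /\
  (forall X S, S \subset L -> nbs Nb S \subset X -> row_rank H X + #|S| <= #|X|).

Section Represented.
Variables (F : fieldType) (r : nat) (H : 'M[F]_(m, r)).
Variables (Nb : 'I_m -> {set 'I_m}) (L : {set 'I_m}).
Hypothesis repH : nbs_represented H Nb L.

Lemma row_rank_nbs X S : S \subset L -> row_rank H X + #|S| <= #|X :|: nbs Nb S|.
Proof.
move=> sSL; have := repH.2 _ _ sSL (subsetUr X (nbs Nb S)).
by have := row_rankS H (subsetUl X (nbs Nb S)); rank_lia.
Qed.

Lemma hall_indepE X : hall_indep Nb L X = (row_rank H X == #|X|).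
Proof.
apply/hall_indepP/eqP => [hX|rX S sSL]; last by rewrite -rX row_rank_nbs.
have [S sSL leS] := repH.1 X; have hS := hX S sSL.
by apply/eqP; rewrite eqn_leq row_rank_leq_card; rank_lia.
Qed.

Definition flat_tails X := [set u in L | Nb u \subset row_closure H X].

Lemma flat_tails_sub X : flat_tails X \subset L.
Proof. by apply/subsetP=> u; rewrite inE => /andP[]. Qed.

Lemma nbs_flat_tails X : nbs Nb (flat_tails X) \subset row_closure H X.
Proof. by apply/nbs_subP=> u; rewrite inE => /andP[]. Qed.

(** A set [S] attaining the rank of the closure [P] has all its neighbours in [P], since adding them
    does not raise the rank. Hence [S] lies in [flat_tails X], and the latter attains the rank of
    [P] as well. *)
Lemma card_flat X : #|row_closure H X| = row_rank H X + #|flat_tails X|.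
Proof.
have rP := row_rank_closure H X; set P := row_closure H X in rP *.
apply/eqP; rewrite eqn_leq andbC -{1}rP.
rewrite repH.2 ?flat_tails_sub ?nbs_flat_tails //=.
have [S sSL leS] := repH.1 P; have sN : nbs Nb S \subset P.
  have le2 := repH.2 _ _ sSL (subsetUr P (nbs Nb S)).
  have : P :|: nbs Nb S \subset row_closure H X.
    apply: sub_closure_rank; last by rank_lia.
    exact: subset_trans (sub_row_closure _ _) (subsetUl _ _).
  by apply: subset_trans; rewrite subsetUr.
have sS : #|S| <= #|flat_tails X|.
  apply: leq_cards; apply/subsetP=> u uS; rewrite inE (subsetP sSL) //=.
  by move/nbs_subP: sN; apply.
move: leS; rewrite (setUidPl sN); rank_lia.
Qed.

Lemma hall_indep_augment X Y : hall_indep Nb L X -> hall_indep Nb L Y ->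
  #|X| < #|Y| -> exists2 y, y \in Y :\: X & hall_indep Nb L (y |: X).
Proof.
rewrite !hall_indepE => /eqP rX /eqP rY ltXY.
have [y yY yX] : exists2 y, y \in Y & y \notin row_closure H X.
  apply/subsetPn; apply: contraL ltXY => sYX; rewrite -leqNgt -rX -rY.
  by rewrite -(row_rank_closure H X) row_rankS.
have yXn : y \notin X by apply: contra yX; apply/subsetP/sub_row_closure.
exists y; first by rewrite inE yXn.
rewrite hall_indepE eqn_leq row_rank_leq_card cardsU1 yXn add1n -rX.
exact: row_rankU1.
Qed.

End Represented.

(** Closed in-neighbourhoods. Only arcs that leave non-targets are reversed. With non-targets [~: E]
    they describe the gammoid of the reversed digraph with targets [E]. *)
Definition reversed_nbs Nb L u := [set c | (c == u) || (c \in L) && (u \in Nb c)].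

(** The inequality says that [S] attains the rank of [A], the opposite one being [row_rank_nbs]. *)
Definition essential (F : fieldType) r (H : 'M[F]_(m, r)) Nb L E v :=
  [exists A : {set 'I_m}, (A \subset E) && [forall S : {set 'I_m},
     [&& S \subset L & #|A :|: nbs Nb S| <= row_rank H A + #|S|] ==>
     (v \in nbs Nb S) && (v \notin S)]].

Section Essential.
Variables (F : fieldType) (r g : nat) (H : 'M[F]_(m, r)) (G : 'M[F]_(m, g)).
Variables (Nb : 'I_m -> {set 'I_m}) (L E : {set 'I_m}).
Hypothesis diag : {in L, forall u, u \in Nb u}.
Hypothesis repH : nbs_represented H Nb L.
Hypothesis repG : nbs_represented G (reversed_nbs Nb L) (~: E).

Section EssentialVertex.
Variables (v : 'I_m) (A : {set 'I_m}).
Hypotheses (vL : v \in L) (vE : v \notin E) (sAE : A \subset E).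
Hypothesis essA : forall S, S \subset L ->
  #|A :|: nbs Nb S| <= row_rank H A + #|S| -> v \in nbs Nb S /\ v \notin S.

Variables P S : {set 'I_m}.
Hypotheses (defP : P = row_closure H A) (defS : S = flat_tails H Nb L A).

Let sAP : A \subset P. Proof. by rewrite defP sub_row_closure. Qed.
Let cP : #|P| = row_rank H A + #|S|. Proof. by rewrite defP defS (card_flat repH). Qed.
Let sSL : S \subset L. Proof. by rewrite defS flat_tails_sub. Qed.
Let sNP : nbs Nb S \subset P. Proof. by rewrite defP defS nbs_flat_tails. Qed.
Let sSP : S \subset P. Proof. exact: subset_trans (sub_nbs diag sSL) sNP. Qed.

Lemma essential_boundary : v \in nbs Nb S /\ v \notin S.
Proof.
have leAS : #|A :|: nbs Nb S| <= #|P| by apply: leq_cards; rewrite subUset sAP.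
by apply: essA; rewrite // -cP.
Qed.

(** If [S'] attains the rank of [P :\: S], then [S :|: S'] bounds the rank of [A]. Its neighbourhood
    together with [A] exceeds [P :\: S :|: nbs Nb S'] by at most [S :\: S'], so the rank of
    [P :\: S] is at least that of [A], which is [#|P :\: S|]. *)
Lemma rank_boundary : row_rank H (P :\: S) = #|P :\: S|.
Proof.
have cK : #|P :\: S| = row_rank H A.
  by have := cardsID S P; rewrite (setIidPr sSP) cP; rank_lia.
apply/eqP; rewrite eqn_leq row_rank_leq_card cK /=.
have [S' sS'L leS'] := repH.1 (P :\: S).
have sU : S :|: S' \subset L by rewrite subUset sSL.
have leU := row_rank_nbs repH A sU.
have : #|A :|: nbs Nb (S :|: S')| <= #|(P :\: S :|: nbs Nb S') :|: (S :\: S')|.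
  apply: leq_cards; rewrite nbsU; apply/subsetP=> x; rewrite !(in_setU, in_setD) => xU.
  have [xS'|xS'] := boolP (x \in S').
    by rewrite (subsetP (sub_nbs diag sS'L)) ?orbT.
  case: (x \in nbs Nb S') xU; rewrite ?orbT // !orbF => /orP[/(subsetP sAP)|/(subsetP sNP)] ->.
    by case: (x \in S).
  by case: (x \in S).
have := cardsU (P :\: S :|: nbs Nb S') (S :\: S').
have := cardsU S S'; have := cardsID S' S; rank_lia.
Qed.

Lemma essential_notin_closure : v \notin row_closure H (P :\: S :\ v).
Proof.
have rK := rank_boundary; have [vN vS] := essential_boundary.
have vP : v \in P by apply: (subsetP sNP).
have sKv : P :\: S :\ v \subset P :\: S by apply: subsetDl.
apply/negP=> vKv.
have vK : v \in P :\: S by rewrite in_setD vS.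
have : row_rank H (P :\: S) <= row_rank H (P :\: S :\ v).
  rewrite -[leqRHS]row_rank_closure row_rankS //; apply/subsetP=> x xK.
  have [->//|xv] := eqVneq x v.
  by apply: (subsetP (sub_row_closure _ _)); rewrite in_setD1 xv.
have := row_rank_leq_card H (P :\: S :\ v); rewrite rK (cardsD1 v (P :\: S)) vK; rank_lia.
Qed.

(** Let [P2] be the closure of [~: S] in the reversed gammoid. If every in-neighbour of [v] were in
    [P2], then [~: P2] would also attain the rank of [A]. As [v] is essential it would have an
    in-neighbour in [~: P2], a contradiction. *)
Lemma essential_in_neighbor :
  exists c, [/\ v \in Nb c, c \in L & c \notin row_closure G (~: S)].
Proof.
have [vN vS] := essential_boundary.
have sQP2 := sub_row_closure G (~: S).
have cP2 := card_flat repG (~: S).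
have S2E u : (u \in flat_tails G (reversed_nbs Nb L) (~: E) (~: S)) =
    (u \notin E) && (reversed_nbs Nb L u \subset row_closure G (~: S)).
  by rewrite !inE.
move: (row_closure G (~: S)) (flat_tails G _ _ _) => P2 S2 in sQP2 cP2 S2E *.
have [/existsP[c /and3P[vc cL cP2n]]|] := boolP [exists c, [&& v \in Nb c, c \in L & c \notin P2]].
  by exists c.
rewrite negb_exists => /forallP noc.
have vS2 : v \in S2.
  rewrite S2E vE; apply/subsetP=> c; rewrite inE => /orP[/eqP ->|/andP[cL vc]].
    by apply: (subsetP sQP2); rewrite inE.
  by have := noc c; rewrite vc cL negbK.
have sS1S : ~: P2 \subset S by rewrite -[S]setCK setCS.
have [vN1 _] : v \in nbs Nb (~: P2) /\ v \notin ~: P2.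
  apply: essA; first exact: subset_trans sSL.
  (* The set [S2] of vertices outside [E] whose in-neighbours all lie in [P2] meets neither [A] nor
     the neighbours of [~: P2]. *)
  have : #|A :|: nbs Nb (~: P2)| <= #|P :\: S2|.
    apply: leq_cards; rewrite subUset; apply/andP; split; apply/subsetP=> x.
      by move=> xA; rewrite inE S2E (subsetP sAP) // (subsetP sAE).
    move=> xN; rewrite inE (subsetP sNP) ?(subsetP (nbsS Nb sS1S)) // andbT.
    have /nbsP[c cS1 xc] := xN; have cL : c \in L by apply/(subsetP sSL)/(subsetP sS1S).
    move: cS1; rewrite inE; apply: contra; rewrite S2E => /andP[_ /subsetP]; apply.
    by rewrite inE cL xc orbT.
  (* No arc leads from [S] out of [P]. So [~: (P :|: E)] bounds the reversed rank of [~: S], which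
     by [card_flat] bounds [#|P2|] and makes [~: P2] large enough. *)
  have sN2 : nbs (reversed_nbs Nb L) (~: (P :|: E)) \subset ~: S.
    apply/nbs_subP=> u; rewrite !inE negb_or => /andP[uP _]; apply/subsetP=> c.
    rewrite !inE => /orP[/eqP ->|/andP[cL uc]]; first by apply: contra uP; apply: (subsetP sSP).
    apply: contra uP => cS; apply: (subsetP sNP); apply/nbsP; exists c => //.
  have := repG.2 (~: S) (~: (P :|: E)); rewrite setCS subsetUr => /(_ isT sN2).
  have : #|S2| <= #|(P :&: S2) :|: ~: (P :|: E)|.
    apply: leq_cards; apply/subsetP=> x xS2; have := xS2; rewrite S2E => /andP[xE _].
    by rewrite !(in_setU, in_setI, in_setC) xS2 (negPf xE) andbT orbF orbN.
  have := cardsU (P :&: S2) (~: (P :|: E)).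
  have := cardsID S2 P; have := cardsC S; have := cardsC P2; rank_lia.
have /nbsP[c cS1 vc] := vN1; have cL : c \in L by apply/(subsetP sSL)/(subsetP sS1S).
by have := noc c; rewrite vc cL; move: cS1; rewrite inE => ->.
Qed.

Lemma essential_separation :
  exists c b (y1 : 'cV[F]_g) (y2 y3 : 'cV[F]_r),
    [/\ (row c G *m y1 != 0)%R, (row b H *m y2 != 0)%R, (row v H *m y3 != 0)%R,
        [/\ v \in Nb c, c \in L & b \in Nb v] &
        forall u c' b', u != v -> u \in L -> [/\ u \in Nb c', c' \in L & b' \in Nb u] ->
        [\/ (row c' G *m y1 = 0)%R, (row b' H *m y2 = 0)%R | (row u H *m y3 = 0)%R]].
Proof.
have [vN vS] := essential_boundary.
have [b bNv bP] : exists2 b, b \in Nb v & b \notin P.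
  by apply/subsetPn; move: vS; rewrite defS inE vL -defP.
have [y2 [y2P y2b]] : exists y : 'cV[F]_r,
    (forall i, i \in P -> (row i H *m y = 0)%R) /\ (row b H *m y != 0)%R.
  by rewrite defP; apply: row_separation; rewrite -defP.
have [y3 [y3K y3v]] := row_separation essential_notin_closure.
have [c [vNc cL cQ]] := essential_in_neighbor.
have [y1 [y1Q y1c]] := row_separation cQ.
exists c, b, y1, y2, y3; split=> // u c' b' uv uL [uc' c'L b'u].
(* The three functionals split the possible places of [u]: outside [P] its in-neighbour [c'] avoids
   [S], in [P :\: S] it differs from [v], and in [S] its neighbour [b'] lies in [P]. *)
case: (boolP (u \in P)) => uP; last first.
  constructor 1; apply/y1Q/(subsetP (sub_row_closure _ _)); rewrite in_setC.
  apply: contra uP => c'S.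
  by apply: (subsetP sNP); apply/nbsP; exists c'.
case: (boolP (u \in S)) => uS; last first.
  by constructor 3; apply/y3K/(subsetP (sub_row_closure _ _)); rewrite !(in_setD, in_set1) uv uS.
by constructor 2; apply: y2P; apply: (subsetP sNP); apply/nbsP; exists u.
Qed.

End EssentialVertex.

Lemma essential_bound : #|[set v in L :\: E | essential H Nb L E v]| <= g * (r * r).
Proof.
set Z := [set v in _ | _].
have /fin_all_exists[t tP] (v : 'I_m) : exists t : 'I_m * 'I_m * 'cV[F]_g * 'cV[F]_r * 'cV[F]_r,
    let: (c, b, y1, y2, y3) := t in v \in Z ->
    [/\ (row c G *m y1 != 0)%R, (row b H *m y2 != 0)%R, (row v H *m y3 != 0)%R,
        [/\ v \in Nb c, c \in L & b \in Nb v] &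
        forall u c' b', u != v -> u \in L -> [/\ u \in Nb c', c' \in L & b' \in Nb u] ->
        [\/ (row c' G *m y1 = 0)%R, (row b' H *m y2 = 0)%R | (row u H *m y3 = 0)%R]].
  case: (boolP (v \in Z)) => [|_]; last by exists (v, v, 0, 0, 0)%R.
  rewrite !inE => /andP[/andP[vE vL] /existsP[A /andP[sAE /forallP hA]]].
  have essA S : S \subset L -> #|A :|: nbs Nb S| <= row_rank H A + #|S| ->
      v \in nbs Nb S /\ v \notin S.
    by move=> sSL leS; apply/andP; apply: (implyP (hA S)); rewrite sSL.
  have [c [b [y1 [y2 [y3 sep]]]]] := essential_separation vL vE sAE essA erefl erefl.
  by exists (c, b, y1, y2, y3).
apply: (@triple_tensor_bound F _ Z _ _ _
  (fun v => row (t v).1.1.1.1 G) (fun v => row (t v).1.1.1.2 H) (fun v => row v H)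
  (fun v => (t v).1.1.2) (fun v => (t v).1.2) (fun v => (t v).2)).
  by move=> v vZ; have := tP v; case: (t v) => [[[[c b] y1] y2] y3] /(_ vZ)[].
move=> u v uZ vZ uv; have := tP u; have := tP v.
case: (t v) => [[[[c b] y1] y2] y3] /(_ vZ)[_ _ _ _ tv].
case: (t u) => [[[[c' b'] y1'] y2'] y3'] /(_ uZ)[_ _ _ cbu _].
by apply: tv => //; move: uZ; rewrite !inE => /andP[/andP[]].
Qed.

End Essential.

End Hall.

(** * Reduction to few vertices *)

Section Kernel.
Variable m : nat.
Implicit Types (S X Y L E A B : {set 'I_m}) (Nb : 'I_m -> {set 'I_m}) (u v : 'I_m).

Lemma nbs_represented_rat Nb L : {in L, forall u, u \in Nb u} ->
  exists r (H : 'M[rat]_(m, r)), r + #|L| <= m /\ nbs_represented H Nb L.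
Proof.
by move=> /(nbs_representation rat_poly_nonroot)[r [H [leL H1 H2]]]; exists r, H.
Qed.

(** The vertex [v] stays as an isolated non-target, so that the index type and [L] do not change
    when vertices are bypassed repeatedly. *)
Definition bypass Nb v u :=
  if u == v then [set v] else
  if v \in Nb u then (Nb u :|: Nb v) :\ v else Nb u.

Lemma bypass_diag Nb L v :
  {in L, forall u, u \in Nb u} -> {in L, forall u, u \in bypass Nb v u}.
Proof.
move=> diag u uL; rewrite /bypass; case: eqVneq => [->|uv]; first by rewrite set11.
by case: ifP; rewrite ?inE ?uv diag.
Qed.

Lemma nbs_bypass Nb v S : v \notin S ->
  nbs (bypass Nb v) S =
    if v \in nbs Nb S then (nbs Nb S :|: Nb v) :\ v else nbs Nb S.
Proof.
move=> vS; have neq u : u \in S -> (u == v) = false.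
  by move=> uS; apply: contraNF vS => /eqP <-.
apply/setP=> x; apply/nbsP/idP => [[u uS]|].
  rewrite /bypass neq //; case: (boolP (v \in Nb u)) => [vu|vu xu].
    have -> : v \in nbs Nb S by apply/nbsP; exists u.
    rewrite !inE => /andP[-> /orP[xu|->]]; last by rewrite orbT.
    by apply/orP; left; apply/nbsP; exists u.
  have xN : x \in nbs Nb S by apply/nbsP; exists u.
  by case: ifP => // _; rewrite !inE xN andbT; apply: contraNneq vu => <-.
case: (boolP (v \in nbs Nb S)) => [/nbsP[u uS vu]|vN /nbsP[u uS xu]].
  rewrite !inE => /andP[xv /orP[/nbsP[w wS xw]|xNv]].
    exists w; rewrite // /bypass neq //; case: ifP => // _.
    by rewrite !inE xv xw.
  by exists u; rewrite // /bypass neq // vu !inE xv xNv orbT.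
exists u; rewrite // /bypass neq //; case: ifP => // vu.
by case/negP: vN; apply/nbsP; exists u.
Qed.

(** Since [v] is not essential, some [S] attaining the rank of [X] has [v] outside [nbs Nb S :\: S].
    Bypassing does not enlarge the neighbourhood of this [S], so Hall's condition for it gives full
    rank. The converse compares Hall's condition set by set. *)
Lemma bypass_indep (F : fieldType) r (H : 'M[F]_(m, r)) Nb L E v :
  {in L, forall u, u \in Nb u} -> nbs_represented H Nb L ->
  v \in L -> v \notin E -> ~~ essential H Nb L E v ->
  forall X, X \subset E -> hall_indep (bypass Nb v) L X = hall_indep Nb L X.
Proof.
move=> diag repH vL vE ness X sXE; have vX : v \notin X by apply: contra vE; apply/subsetP.
apply/idP/idP => /hall_indepP hX.
  have [S sSL [leS vS]] : exists2 S : {set 'I_m}, S \subset L &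
      #|X :|: nbs Nb S| <= row_rank H X + #|S| /\ (v \in nbs Nb S -> v \in S).
    move: ness; rewrite negb_exists => /forallP/(_ X); rewrite sXE /= negb_forall.
    case/existsP=> S; rewrite negb_imply negb_and negbK => /andP[/andP[sSL leS] vS].
    by exists S => //; split=> // vN; move: vS; rewrite vN.
  have := hX S sSL; have : #|X :|: nbs (bypass Nb v) S| <= #|X :|: nbs Nb S|.
    apply/leq_cards/setUS; have [vS'|vS'] := boolP (v \in S); last first.
      by rewrite nbs_bypass //; case: ifP => // /vS; rewrite (negPf vS').
    apply/nbs_subP=> u uS.
    have uN x : x \in Nb u -> x \in nbs Nb S by move=> xu; apply/nbsP; exists u.
    have vN x : x \in Nb v -> x \in nbs Nb S by move=> xv; apply/nbsP; exists v.
    apply/subsetP=> x; rewrite /bypass; case: eqVneq => [_|_].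
      by rewrite inE => /eqP ->; apply: vN; apply: diag.
    by case: ifP => _; rewrite ?inE; [case/andP=> _ /orP[/uN|/vN]|apply: uN].
  rewrite (hall_indepE repH) eqn_leq row_rank_leq_card; rank_lia.
apply/hall_indepP=> S sSL; have [vS|vS] := boolP (v \in S); last first.
  rewrite nbs_bypass //; case: ifP => [vN|_]; last exact: hX.
  (* Adding [v] to [S] on the left pays for deleting [v] from the neighbourhood on the right. *)
  have := hX (v |: S); rewrite subUset sub1set vL => /(_ sSL).
  have -> : X :|: (nbs Nb S :|: Nb v) :\ v = (X :|: nbs Nb (v |: S)) :\ v.
    apply/setP=> x; rewrite nbsU1 !inE; case: eqVneq => [->|_] /=; first by rewrite (negPf vX).
    by rewrite [(x \in nbs _ _) || _]orbC.
  rewrite cardsU1 vS [X in _ <= X](cardsD1 v) inE nbsU1 inE (diag v) //= orbT.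
  rank_lia.
have defS : S = v |: (S :\ v) by rewrite setD1K.
have sS0L : S :\ v \subset L by apply: subset_trans sSL; apply: subsetDl.
have cS : #|S| = #|S :\ v|.+1 by rewrite (cardsD1 v S) vS.
have v0 : v \notin S :\ v by rewrite !inE eqxx.
have byv : bypass Nb v v = [set v] by rewrite /bypass eqxx.
have [vN|vN] := boolP (v \in nbs Nb (S :\ v)); last first.
  have := hX _ sS0L; rewrite [in nbs (bypass _ _) _]defS nbsU1 byv nbs_bypass // (negPf vN).
  by rewrite setUCA cardsU1 inE (negPf vX) (negPf vN) /=; rank_lia.
apply: leq_trans (hX S sSL) _; apply: leq_cards; apply: setUS.
rewrite [in S in nbs (bypass _ _) S]defS [X in nbs Nb X \subset _]defS !nbsU1 byv nbs_bypass // vN.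
by apply/subsetP=> x; rewrite !inE; case: (x == v) => //=; rewrite orbC.
Qed.

Definition active Nb L := [set u in L | Nb u != [set u]].

Lemma active_bypass Nb L v : active (bypass Nb v) L \subset active Nb L :\ v.
Proof.
apply/subsetP=> u; rewrite !inE /bypass; case: (eqVneq u v) => [->|uv] /andP[uL].
  by rewrite eqxx.
rewrite uL /=; apply: contra => /eqP eu.
have -> : (v \in Nb u) = false by rewrite eu inE eq_sym (negPf uv).
exact/eqP.
Qed.

(** Active vertices outside [E] that are not essential are bypassed one by one. Each bypass makes
    [v] inactive and activates no vertex. The remaining ones are essential and hence few. The
    dimensions [g] and [r] are bounded by the numbers of targets [E] and [~: L]. *)
Lemma few_active Nb L E : {in L, forall u, u \in Nb u} ->
  exists Nb', [/\ {in L, forall u, u \in Nb' u},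
    forall X, X \subset E -> hall_indep Nb' L X = hall_indep Nb L X &
    #|active Nb' L :\: E| <= #|E| * (#|~: L| * #|~: L|)].
Proof.
have [n] := ubnP #|active Nb L|; elim: n Nb => // n IHn Nb; rewrite ltnS => lt_n diag.
have [r [H [rL repH]]] := nbs_represented_rat diag.
have diag2 : {in ~: E, forall u, u \in reversed_nbs Nb L u}.
  by move=> u _; rewrite inE eqxx.
have [g [G [gE repG]]] := nbs_represented_rat diag2.
have [/existsP[v /and3P[vact vE ness]]|] :=
    boolP [exists v, [&& v \in active Nb L, v \notin E & ~~ essential H Nb L E v]].
  have vL : v \in L by move: vact; rewrite inE => /andP[].
  have [|Nb' [diag' ind' le']] := IHn (bypass Nb v) _ (@bypass_diag Nb L v diag).
    apply: leq_trans lt_n; rewrite (cardsD1 v (active Nb L)) vact ltnS.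
    exact/leq_cards/active_bypass.
  by exists Nb'; split=> // X sXE; rewrite ind' // (bypass_indep diag repH vL vE ness).
rewrite negb_exists => /forallP allE; exists Nb; split=> //.
have := essential_bound diag repH repG.
have : #|active Nb L :\: E| <= #|[set v in L :\: E | essential H Nb L E v]|.
  apply: leq_cards; apply/subsetP=> v; rewrite in_setD => /andP[vE vact].
  have := allE v; rewrite vact vE negbK !inE vE => ->; rewrite andbT.
  by move: vact; rewrite inE => /andP[].
have leg : g <= #|E| by have := cardsC E; rewrite card_ord; rank_lia.
have ler : r <= #|~: L| by have := cardsC L; rewrite card_ord; rank_lia.
move=> le1 le2; apply: leq_trans le1 (leq_trans le2 _).
by rewrite !leq_mul.
Qed.

(* The new targets form a minimum cut [P :\: S] separating [E] from the old ones. *)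
Lemma few_targets Nb L E : {in L, forall u, u \in Nb u} ->
  exists L' Nb', [/\ {in L', forall u, u \in Nb' u},
    forall X, X \subset E -> hall_indep Nb' L' X = hall_indep Nb L X &
    exists B, [/\ B \subset E, hall_indep Nb L B & #|~: L'| <= #|B|]].
Proof.
move=> diag; have [r [H [rL repH]]] := nbs_represented_rat diag.
have [S sSL leS] := repH.1 E; have sSN := sub_nbs diag sSL.
(* Only the arcs leaving [S] survive. Vertices outside [P] become isolated non-targets, which leaves
   [P :\: S] as targets. *)
pose Nb' u := if u \in S then Nb u else [set u].
have [P [defP sEP sNP]] : exists P, [/\ P = E :|: nbs Nb S, E \subset P & nbs Nb S \subset P].
  by exists (E :|: nbs Nb S); split; rewrite ?subsetUl ?subsetUr.
have sSP := subset_trans sSN sNP; rewrite -defP in leS.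
have nbs'1 S' : S' \subset S -> nbs Nb' S' = nbs Nb S'.
  by move=> sS'; apply: eq_bigr => u uS'; rewrite /Nb' (subsetP sS').
have nbs'2 S' : S' \subset ~: P -> nbs Nb' S' = S'.
  move=> sS'; apply/setP=> x; apply/nbsP/idP => [[u uS']|xS'].
    rewrite /Nb' ifF ?inE => [/eqP -> //|]; apply: contraTF uS' => /(subsetP sSP) uP.
    by apply: contraL uP => /(subsetP sS'); rewrite inE.
  exists x; rewrite // /Nb' ifF ?set11 //; apply: contraTF xS' => /(subsetP sSP) uP.
  by apply: contraL uP => /(subsetP sS'); rewrite inE.
exists (S :|: ~: P), Nb'; split.
- move=> u; rewrite /Nb' !inE; case: (boolP (u \in S)) => uS _; last exact: set11.
  by apply: diag; apply: (subsetP sSL).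
- move=> X sXE; have sXP := subset_trans sXE sEP; apply/hall_indepP/hall_indepP => hX S'.
    (* Uncrossing: [S :&: S'] is tested by the new Hall condition and [S :|: S'] against the rank of
       [E], which [S] attains. The two bounds add up to the one for [S']. *)
    move=> sS'L; have sI : S :&: S' \subset S by apply: subsetIl.
    have := hX _ (subset_trans sI (subsetUl _ _)); rewrite nbs'1 //.
    have sU : S :|: S' \subset L by rewrite subUset sSL.
    have := row_rank_nbs repH E sU; have := cardsUI S S'.
    have := cardsUI (X :|: nbs Nb S') P.
    have : #|E :|: nbs Nb (S :|: S')| <= #|(X :|: nbs Nb S') :|: P|.
      by apply: leq_cards; rewrite defP nbsU; apply/subsetP=> x; rewrite !inE;
         case: (x \in E); case: (x \in X); case: (x \in nbs _ _); case: (x \in nbs _ _).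
    have : #|X :|: nbs Nb (S :&: S')| <= #|(X :|: nbs Nb S') :&: P|.
      apply: leq_cards; rewrite subsetI !subUset subsetUl sXP /=.
      rewrite (subset_trans (nbsS _ (subsetIr _ _))) ?subsetUr //.
      exact: subset_trans (nbsS _ sI) sNP.
    rank_lia.
  move=> sS'; have sI : S' :&: S \subset S by apply: subsetIr.
  have sD : S' :\: S \subset ~: P.
    by apply/subsetP=> x; rewrite inE => /andP[xS /(subsetP sS')]; rewrite inE (negPf xS).
  have := hX _ (subset_trans sI sSL); rewrite -[in nbs Nb' S'](setID S' S) nbsU nbs'1 // nbs'2 //.
  rewrite setUA [in X in _ -> _ <= X]cardsU.
  have -> : (X :|: nbs Nb (S' :&: S)) :&: (S' :\: S) = set0.
    apply/eqP; rewrite setI_eq0 disjoint_sym disjoints_subset (subset_trans sD) //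
      setCS subUset sXP.
    exact: subset_trans (nbsS _ sI) sNP.
  by rewrite cards0; have := cardsID S S'; rank_lia.
have [B [sBE rB rBE]] := row_basis H E; exists B; split=> //.
  by rewrite (hall_indepE repH) rB.
have := cardsID S P; rewrite (setIidPr sSP) setCU setCK setIC -setDE; rank_lia.
Qed.

(** The targets are reduced first, because their number enters the bound on active vertices, and
    bypassing keeps [L]. *)
Lemma kernel Nb L E : {in L, forall u, u \in Nb u} ->
  exists L' Nb', [/\ {in L', forall u, u \in Nb' u},
    forall X, X \subset E -> hall_indep Nb' L' X = hall_indep Nb L X,
    #|active Nb' L' :\: E| <= #|E| * (#|~: L'| * #|~: L'|) &
    exists B, [/\ B \subset E, hall_indep Nb L B & #|~: L'| <= #|B|]].
Proof.
move=> /few_targets-/(_ E)[L1 [Nb1 [diag1 ind1 exB]]].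
have [Nb2 [diag2 ind2 le2]] := few_active E diag1.
by exists L1, Nb2; split=> // X sXE; rewrite ind2 // ind1.
Qed.

End Kernel.

(** * Hall's theorem from determinants *)

Section Matching.
Import GRing.Theory.
Local Open Scope ring_scope.

(** Full row rank on [L] gives a nonsingular minor, and a nonzero term of its Leibniz expansion is
    the matching. *)
Lemma rank_matching (F : fieldType) m (A : 'M[F]_m) (L : {set 'I_m}) :
  (forall i j, A i j != 0 -> i \in L) -> (#|L| <= \rank A)%N ->
  exists s : 'I_m -> 'I_m, {in L &, injective s} /\ {in L, forall u, A u (s u) != 0}.
Proof.
move=> suppA leLA; pose A1 := rowsub (fun k : 'I_#|L| => enum_val k) A.
have rfA1 : row_full A1^T.
  rewrite /row_full mxrank_tr eqn_leq rank_leq_row (leq_trans leLA) //.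
  apply/mxrankS/row_subP=> i; have [iL|iL] := boolP (i \in L).
    have -> : row i A = row (enum_rank_in iL i) A1.
      by apply/rowP=> j; rewrite !mxE enum_rankK_in.
    exact: row_sub.
  suff -> : row i A = 0 by apply: sub0mx.
  by apply/rowP=> j; rewrite !mxE; apply: contraNeq iL => /suppA.
have := fullrowsub_unit rfA1; set f := fullrankfun rfA1.
rewrite unitmxE unitfE => det0.
have [p pnz] : exists p : 'S_#|L|, forall i, A (enum_val (p i)) (f i) != 0.
  move: det0; case: (boolP [exists p : 'S_#|L|, [forall i, A (enum_val (p i)) (f i) != 0]]).
    by case/existsP=> p /forallP; exists p.
  rewrite negb_exists => /forallP nop; rewrite /determinant big1 ?eqxx // => p _.
  have := nop p; rewrite negb_forall => /existsP[i]; rewrite negbK => /eqP Ai0.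
  by rewrite (bigD1 i) //= !mxE Ai0 mul0r mulr0.
have /fin_all_exists[s sP] (u : 'I_m) : exists w, u \in L ->
    exists2 k, u = enum_val k & w = f ((p^-1)%g k).
  have [uL|_] := boolP (u \in L); last by exists u.
  exists (f ((p^-1)%g (enum_rank_in uL u))) => _.
  by exists (enum_rank_in uL u); rewrite ?enum_rankK_in.
exists s; split=> [u v uL vL|u uL].
  have [k -> ->] := sP u uL; have [l -> ->] := sP v vL.
  by move=> /fullrankfun_inj/perm_inj ->.
by have [k -> ->] := sP u uL; have := pnz ((p^-1)%g k); rewrite permKV.
Qed.

(** Hall's condition forces a generic matrix, restricted to the columns outside [X], to have rank at
    least [#|L|]. *)
Lemma hall_matching m (Nb : 'I_m -> {set 'I_m}) L X :
  hall_indep Nb L X <->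
  exists s : 'I_m -> 'I_m, {in L &, injective s} /\
    {in L, forall u, s u \in Nb u /\ s u \notin X}.
Proof.
split=> [/hall_indepP hX|[s [sinj sN]]]; last first.
  apply/hall_indepP=> S sSL.
  have sS : s @: S \subset nbs Nb S :\: X.
    apply/subsetP=> _ /imsetP[u uS ->]; have [suN suX] := sN u (subsetP sSL u uS).
    by rewrite inE suX; apply/nbsP; exists u.
  have := leq_cards sS; rewrite card_in_imset; last first.
    by move=> u v uS vS; apply: sinj; apply: (subsetP sSL).
  by have := cardsU X (nbs Nb S); have := cardsID X (nbs Nb S); rewrite setIC; rank_lia.
have [W [Ws Wr]] := generic_matrix Nb rat_poly_nonroot L.
have suppW i j : (W *m cmask (~: X)) i j != 0 -> [/\ i \in L, j \in Nb i & j \notin X].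
  rewrite mul_cmaskE inE; case: (j \in X); rewrite ?mulr0n ?eqxx // mulr1n.
  by move/Ws=> [].
have [||s [sinj sW]] := @rank_matching _ _ (W *m cmask (~: X)) L.
- by move=> i j /suppW[].
- have [S sSL leS] := Wr (~: X); have := hX S sSL; rewrite cardsU -setDE in leS *.
  by have := cardsID X (nbs Nb S); rewrite setIC; rank_lia.
by exists s; split=> // u uL; have [] := suppW _ _ (sW u uL).
Qed.

End Matching.

(** * Routings, minors and isomorphisms *)

Section Routing.
Local Open Scope fset_scope.
Variables (U : choiceType) (D : digraph U) (T X : {fset U}).
Local Notation V := (vertices D).

(* [s] moves every vertex that is not a target one step along its path. *)
Definition successor_map (s : U -> U) :=
  {in V `\` T &, injective s} /\
  forall u, u \in V `\` T ->
    [/\ s u \in V, s u \notin X & s u = u \/ (u, s u) \in arcs D].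

(** A non-target on a path is not its last vertex, so it has a next one. Vertices off all paths stay
    fixed. Elements of [X] have index 0 on their paths and are therefore never successors. *)
Lemma successor_of_routing R : is_routing D X T R -> exists s, successor_map s.
Proof.
case=> pathR startR endR disjR.
have sameR p q x : p \in R -> q \in R -> x \in p -> x \in q -> p = q.
  by move=> pR qR xp xq; apply/eqP; apply: contraT => /eqP/(disjR _ _ pR qR)/(_ _ xp); rewrite xq.
(* The path through [u], or the empty sequence if there is none, so that [u \in P u] says that [u]
   lies on a path. *)
pose P u := head [::] [seq p <- (R : seq _) | u \in p].
have PE u p : p \in R -> u \in p -> P u = p.
  move=> pR up; have : p \in [seq p <- (R : seq _) | u \in p] by rewrite mem_filter up.
  rewrite /P; case E: [seq _ <- _ | _] => [//|q s] _ /=.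
  have : q \in [seq p <- (R : seq _) | u \in p] by rewrite E mem_head.
  by rewrite mem_filter => /andP[uq qR]; apply: sameR uq up.
have PR u : u \in P u -> P u \in R.
  rewrite /P; case E: [seq _ <- _ | _] => [//|q s] _ /=.
  have : q \in [seq p <- (R : seq _) | u \in p] by rewrite E mem_head.
  by rewrite mem_filter => /andP[].
pose s u := if u \in P u then nth u (P u) (index u (P u)).+1 else u.
have lt_next u : u \notin T -> u \in P u -> (index u (P u)).+1 < size (P u).
  move=> uT uP; have [y [yT [q pq]]] := endR _ (PR _ uP).
  move: uP; rewrite pq mem_rcons inE => /orP[/eqP uy|uq]; first by rewrite uy yT in uT.
  by rewrite size_rcons ltnS -cats1 index_cat uq index_mem.
have sP u : u \notin T -> u \in P u -> s u \in P u.
  by move=> uT uP; rewrite /s uP mem_nth // lt_next.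
have Ps u : u \notin T -> u \in P u -> P (s u) = P u.
  by move=> uT uP; apply: PE; [apply: PR|apply: sP].
have sindex u : u \notin T -> u \in P u -> index (s u) (P u) = (index u (P u)).+1.
  by move=> uT uP; have [_ _ uq _] := pathR _ (PR _ uP); rewrite {1}/s uP index_uniq // lt_next.
exists s; split=> [u w|u]; rewrite !in_fsetD.
  move=> /andP[uT uV] /andP[wT wV]; have [uP|uP] := boolP (u \in P u); last first.
    have -> : s u = u by rewrite /s (negPf uP).
    have [wP|wP] := boolP (w \in P w); last by rewrite /s (negPf wP).
    by move=> usw; move: uP; rewrite usw Ps // sP.
  have [wP|wP] := boolP (w \in P w); last first.
    rewrite {2}/s (negPf wP) => suw; move: wP.
    by rewrite -suw Ps // sP.
  move=> suw; have Puw : P u = P w by rewrite -(Ps u) // suw Ps.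
  have := sindex u uT uP; rewrite suw Puw sindex // => -[iuw].
  by rewrite -[u](nth_index u uP) -[w in RHS](nth_index u wP) Puw iuw.
move=> /andP[uT uV]; have [uP|uP] := boolP (u \in P u); last first.
  have -> : s u = u by rewrite /s (negPf uP).
  split=> //; last by left.
  apply/negP=> /startR[p [pR [q pq]]]; move: uP.
  by rewrite (PE u p) // pq mem_head.
have [_ sPV uniqP sortP] := pathR _ (PR _ uP).
split; first exact/sPV/sP.
  apply/negP=> /startR[p [pR [q pq]]].
  have : index (s u) (P u) = 0.
    by rewrite -(Ps u) // (PE _ p) // pq /= ?eqxx ?mem_head.
  by rewrite sindex.
right; have /(sortedP u)/(_ _ (lt_next u uT uP)) := sortP.
by rewrite nth_index // /s uP.
Qed.

(** The paths are the orbits of [s] from [X], stopped at the first target. A collision within or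
    between orbits can be traced back, by injectivity of [s], to a starting vertex in the image of
    [s], which avoids [X]. *)
Lemma routing_of_successor s : X `<=` V -> successor_map s ->
  exists R, is_routing D X T R.
Proof.
move=> /fsubsetP sXV [sinj sN].
have sV u : u \in V -> u \notin T -> [/\ s u \in V, s u \notin X & s u = u \/ (u, s u) \in arcs D].
  by move=> uV uT; apply: sN; rewrite in_fsetD uT.
have iterV i x : x \in X -> (forall a, a < i -> iter a s x \notin T) -> iter i s x \in V.
  move=> xX; elim: i => [|i IHi] nT; first exact: sXV.
  by have [] := sV (iter i s x) (IHi (fun a ai => nT a (ltnW ai))) (nT i (leqnn _)).
have iter_inj i j x y : x \in X -> y \in X ->
    (forall a, a < i -> iter a s x \notin T) -> (forall b, b < j -> iter b s y \notin T) ->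
    iter i s x = iter j s y -> i = j /\ x = y.
  move=> xX yX; elim: i j => [|i IHi] [|j] nTx nTy //.
  - move=> exy; have jV := iterV j y yX (fun b bj => nTy b (ltnW bj)).
    by have [] := sV _ jV (nTy j (leqnn _)); rewrite -iterS -exy /= xX.
  - move=> exy; have iV := iterV i x xX (fun a ai => nTx a (ltnW ai)).
    by have [] := sV _ iV (nTx i (leqnn _)); rewrite -iterS exy /= yX.
  have nTx' a : a < i -> iter a s x \notin T by move=> ai; apply/nTx/ltnW.
  have nTy' b : b < j -> iter b s y \notin T by move=> bj; apply/nTy/ltnW.
  move=> /sinj; rewrite !in_fsetD nTx // nTy // !iterV // => /(_ isT isT) exy.
  by have [-> ->] := IHi j nTx' nTy' exy.
pose k x := find (fun y => y \in T) (traject s x #|` V|.+1).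
have kP x : x \in X -> iter (k x) s x \in T /\ forall a, a < k x -> iter a s x \notin T.
  move=> xX; have hasT : has (fun y => y \in T) (traject s x #|` V|.+1).
    apply: contraT => noT; have nT a : a < #|` V|.+1 -> iter a s x \notin T.
      move=> aV; apply: contra noT => aT; apply/hasP; exists (iter a s x) => //.
      by apply/trajectP; exists a.
    have nTl i : i < #|` V|.+1 -> forall a, a < i -> iter a s x \notin T.
      by move=> iV a ai; apply/nT/(ltn_trans ai).
    have : size (traject s x #|` V|.+1) <= size V.
      apply: uniq_leq_size.
        apply/(uniqP x) => i j; rewrite !inE size_traject => iV jV; rewrite !nth_traject //.
        by move=> /(iter_inj i j x x xX xX (nTl i iV) (nTl j jV))[].
      by move=> _ /trajectP[i iV ->]; apply: iterV (nTl i iV).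
    by rewrite size_traject ltnn.
  have kV : k x < #|` V|.+1 by rewrite -[ltnRHS](size_traject s x) -has_find.
  split; first by have := nth_find x hasT; rewrite nth_traject.
  move=> a ak; have := before_find x ak; rewrite nth_traject ?(ltn_trans ak) // => ->.
  by [].
pose p x := traject s x (k x).+1.
have nTk x i : x \in X -> i < (k x).+1 -> forall a, a < i -> iter a s x \notin T.
  by move=> xX ik a ai; apply: (kP x xX).2; apply: leq_trans ai _.
exists (p @` X); split.
- move=> _ /imfsetP[x /= xX ->]; split=> //.
  + by move=> _ /trajectP[i ik ->]; apply: iterV => //; apply: nTk.
  + apply/(uniqP x) => i j; rewrite !inE size_traject => ik jk; rewrite !nth_traject //.
    by move=> /(iter_inj i j x x xX xX (nTk x i xX ik) (nTk x j xX jk))[].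
  + apply/(sortedP x) => i; rewrite size_traject => ik; rewrite !nth_traject //; last exact: ltnW.
    have nTi := nTk x i xX (ltnW ik).
    have [_ _ []] // := sV _ (iterV i x xX nTi) (nTk x i.+1 xX ik i (leqnn _)).
    rewrite -iterS => /(iter_inj i.+1 i x x xX xX (nTk x _ xX ik) nTi)[/eqP].
    by rewrite eqn_leq ltnn.
- move=> x xX; exists (p x); split; first by apply/imfsetP; exists x.
  by exists (traject s (s x) (k x)).
- move=> _ /imfsetP[x /= xX ->]; exists (iter (k x) s x); split; first exact: (kP x xX).1.
  by exists (traject s x (k x)); rewrite /p trajectSr.
move=> _ _ /imfsetP[x /= xX ->] /imfsetP[y /= yX ->] pxy _ /trajectP[i ik ->].
apply/trajectP=> -[j jk exy]; apply: pxy.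
by have [_ ->] := iter_inj i j x y xX yX (nTk x i xX ik) (nTk y j yX jk) exy.
Qed.

End Routing.

(** * Dual transversal presentations *)

Section Copresentation.
Local Open Scope fset_scope.

(* The dual of the transversal matroid of [(Nb i)_(i in K)] on [V]. *)
Definition copresents (U I : choiceType) (V : {fset U}) (K : {fset I})
    (Nb : I -> U -> Prop) (X : {fset U}) :=
  exists t : I -> U, {in K &, injective t} /\
    forall i, i \in K -> [/\ t i \in V, t i \notin X & Nb i (t i)].

Lemma copresents_routing (U : choiceType) (D : digraph U) (T X : {fset U}) :
  X `<=` vertices D ->
  (exists R, is_routing D X T R) <->
  copresents (vertices D) (vertices D `\` T) (fun u w => w = u \/ (u, w) \in arcs D) X.
Proof.
move=> sXV; split=> [[R /successor_of_routing[s sP]]|[s sP]]; first by exists s.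
exact: (@routing_of_successor _ _ _ _ s).
Qed.

(** Duals of transversal matroids are strict gammoids: a transversal [t0] names each index [i] by
    the vertex [t0 i], with arcs to the members of [Nb i], and the vertices outside the transversal
    are the targets. *)
Lemma copresents_digraph (U I : choiceType) (V : {fset U}) (K : {fset I})
    (Nb : I -> U -> bool) :
  copresents V K Nb fset0 ->
  exists (D : digraph U) (T : {fset U}), [/\ vertices D = V, T `<=` V &
    forall X, X `<=` V -> (exists R, is_routing D X T R) <-> copresents V K Nb X].
Proof.
move=> [t0 [t0inj t0N]].
pose A := [fset a in V `*` V | has (fun i => (t0 i == a.1) && Nb i a.2) K].
have AE a : (a \in A) = (a \in V `*` V) && has (fun i => (t0 i == a.1) && Nb i a.2) K.
  by rewrite /A in_fset inE.
have sAV : A `<=` V `*` V by apply/fsubsetP=> a; rewrite AE => /andP[].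
exists (Digraph sAV), (V `\` t0 @` K); split=> //; first by rewrite fsubsetDl.
have VT : V `\` (V `\` t0 @` K) = t0 @` K.
  apply/fsetP=> x; rewrite !in_fsetD negb_and negbK andbC; case: (boolP (x \in V)) => xV /=.
    by rewrite orbF.
  by apply/esym/negbTE; apply: contra xV => /imfsetP[i /= iK ->]; have [] := t0N i iK.
move=> X sXV; rewrite copresents_routing //= VT; split=> -[s [sinj sN]].
  exists (s \o t0); split=> [i j iK jK /= eij|i iK].
    by apply: t0inj => //; apply: sinj eij; apply/imfsetP; [exists i|exists j].
  have [] := sN (t0 i); first by apply/imfsetP; exists i.
  move=> sV sX sA; split=> //=; case: sA => [->|]; first by have [] := t0N i iK.
  rewrite AE /= => /andP[_ /hasP[j jK /andP[/eqP e Nj]]].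
  by rewrite (t0inj _ _ jK iK e) in Nj.
pose r u := if [seq i <- (K : seq I) | t0 i == u] is i :: _ then s i else u.
have rE i : i \in K -> r (t0 i) = s i.
  move=> iK; have : i \in [seq j <- (K : seq I) | t0 j == t0 i] by rewrite mem_filter eqxx.
  rewrite /r; case E: [seq _ <- _ | _] => [//|j l] _.
  have : j \in [seq j <- (K : seq I) | t0 j == t0 i] by rewrite E mem_head.
  by rewrite mem_filter => /andP[/eqP e jK]; rewrite (t0inj _ _ jK iK e).
exists r; split=> [_ _ /imfsetP[i /= iK ->] /imfsetP[j /= jK ->]|_ /imfsetP[i /= iK ->]].
  by rewrite !rE // => /sinj ->.
rewrite rE //; have [sV sX sNb] := sN i iK; split=> //; right.
rewrite AE in_fsetM /= sV andbT; have [-> _ _] := t0N i iK; apply/hasP; exists i => //.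
by rewrite eqxx.
Qed.

Lemma copresents_transport (U I : choiceType) (f : U -> U) (V' V : {fset U})
    (K : {fset I}) (Nb : I -> U -> bool) (X : {fset U}) :
  {in V' &, injective f} -> f @` V' = V -> X `<=` V' ->
  copresents V' K (fun i x => Nb i (f x)) X <-> copresents V K Nb (f @` X).
Proof.
move=> finj fV /fsubsetP sXV; split=> -[t [tinj tN]].
  exists (f \o t); split=> [i j iK jK /= e|i iK].
    have [tiV _ _] := tN i iK; have [tjV _ _] := tN j jK.
    exact/tinj/finj.
  have [tV tX tNb] := tN i iK; split=> //=; first by rewrite -fV; apply/imfsetP; exists (t i).
  apply: contra tX => /imfsetP[x /= xX e].
  by rewrite (finj _ _ tV (sXV _ xX) e).
pose g y := if [seq x <- (V' : seq U) | f x == y] is x :: _ then x else y.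
have gP y : y \in V -> g y \in V' /\ f (g y) = y.
  rewrite -fV => /imfsetP[x /= xV ->].
  have : x \in [seq z <- (V' : seq U) | f z == f x] by rewrite mem_filter eqxx.
  rewrite /g; case E: [seq _ <- _ | _] => [//|z l] _.
  have : z \in [seq z <- (V' : seq U) | f z == f x] by rewrite E mem_head.
  by rewrite mem_filter => /andP[/eqP].
exists (g \o t); split=> [i j iK jK /= e|i iK /=].
  have [/gP[_ ei] _ _] := tN i iK; have [/gP[_ ej] _ _] := tN j jK.
  by apply: tinj => //; rewrite -ei e ej.
have [/gP[gV eg] tX tNb] := tN i iK; split=> //; last by rewrite eg.
by apply: contra tX => gX; rewrite -eg; apply/imfsetP; exists (g (t i)).
Qed.

End Copresentation.

Section Gammoids.
Local Open Scope fset_scope.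
Variable U : choiceType.
Implicit Types (M N : matroid U) (X Y V B C : {fset U}).

Lemma indep_sub M X : X \in indep M -> X `<=` ground M.
Proof. by have /matroid_axiomsP[h _ _ _] := matroidP M; apply: h. Qed.

Lemma indep0 M : fset0 \in indep M.
Proof. by have /matroid_axiomsP[] := matroidP M. Qed.

Lemma indepS M X Y : X \in indep M -> Y `<=` X -> Y \in indep M.
Proof. by have /matroid_axiomsP[_ _ h _] := matroidP M; apply: h. Qed.

Lemma indep_augment M X Y : X \in indep M -> Y \in indep M -> #|` X| < #|` Y| ->
  exists y, [/\ y \in Y, y \notin X & (y |` X) \in indep M].
Proof. by have /matroid_axiomsP[_ _ _ h] := matroidP M; apply: h. Qed.

Definition copresented (I : choiceType) M V (K : {fset I}) (Nb : I -> U -> bool) :=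
  forall X, X \in indep M <-> X `<=` ground M /\ copresents V K Nb X.

Lemma copresented_of_represents D T M : represents D T M ->
  copresented M (vertices D) (vertices D `\` T) (fun u w => (w == u) || ((u, w) \in arcs D)).
Proof.
move=> [sMV sTV repM] X; rewrite repM; split=> -[sXM].
  have sXV := fsubset_trans sXM sMV; rewrite copresents_routing // => -[t [tinj tN]].
  split=> //; exists t; split=> // i iK; have [? ? tNb] := tN i iK; split=> //.
  by case: tNb => [/eqP ->|->]; rewrite ?orbT.
have sXV := fsubset_trans sXM sMV => -[t [tinj tN]].
split=> //; apply/copresents_routing=> //; exists t; split=> // i iK.
by have [? ? /orP[/eqP tNb|tNb]] := tN i iK; split=> //; [left|right].
Qed.

Lemma represents_of_copresented (I : choiceType) M V (K : {fset I}) Nb :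
  ground M `<=` V -> copresented M V K Nb ->
  exists D T, represents D T M /\ vertices D = V.
Proof.
move=> sMV copM; have [|D [T [DV sTV DTP]]] := @copresents_digraph U I V K Nb.
  by have [] := (copM fset0).1 (indep0 M).
exists D, T; split=> //; split; rewrite ?DV // => X; rewrite copM.
by split=> -[sXM]; have sXV := fsubset_trans sXM sMV; rewrite DTP.
Qed.

Lemma basis_exists M C : exists B, is_basis_of M C B.
Proof.
suff : forall n B, B \in indep M -> B `<=` C -> #|` C| <= #|` B| + n ->
    exists B, is_basis_of M C B.
  by move=> /(_ #|` C| fset0 (indep0 M) (fsub0set _)); apply; rewrite cardfs0.
elim=> [|n IHn] B BM sBC leC.
  exists B; split=> // B' _ sB'C sBB'; have eBC : B = C.
    by apply/eqP; rewrite eqEfcard sBC; rewrite addn0 in leC.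
  by apply/eqP; rewrite eqEfsubset sBB' andbT eBC.
have [/hasP[y yC /andP[yB yBM]]|noy] :=
    boolP (has (fun y => (y \notin B) && (y |` B \in indep M)) C).
  apply: (IHn (y |` B)) => //; first by rewrite fsubUset fsub1set yC.
  by rewrite cardfsU1 yB add1n addSnnS.
exists B; split=> // B' B'M sB'C sBB'; apply/eqP; rewrite eqEfsubset sBB' andbT.
apply/fsubsetP=> y yB'; apply: contraR noy => yB; apply/hasP; exists y.
  exact: (fsubsetP sB'C).
by rewrite yB (indepS B'M) // fsubUset fsub1set yB'.
Qed.

Lemma basis_card M C B B' : is_basis_of M C B -> is_basis_of M C B' ->
  #|` B| <= #|` B'|.
Proof.
move=> [BM sBC _] [B'M sB'C maxB']; rewrite leqNgt; apply/negP=> ltB.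
have [y [yB yB' yBM]] := indep_augment B'M BM ltB.
have syC : y |` B' `<=` C by rewrite fsubUset fsub1set (fsubsetP sBC).
by have := maxB' _ yBM syC (fsubsetUr _ _) => e; rewrite -e fset1U1 in yB'.
Qed.

(** Contraction does not depend on the basis. Subsets of [X] joined to [B'] are augmented from [X]
    and [B]. An added element of [B] would enlarge [B'] inside [C], so it comes from [X]. *)
Lemma contract_basis M C B B' X : is_basis_of M C B -> is_basis_of M C B' ->
  X `&` C = fset0 -> (X `|` B) \in indep M -> (X `|` B') \in indep M.
Proof.
move=> bB bB' XC XBM; have leBB' := basis_card bB bB'; have leB'B := basis_card bB' bB.
have [_ sBC _] := bB; have [B'M sB'C maxB'] := bB'.
suff : forall n Y, Y `<=` X -> (Y `|` B') \in indep M -> #|` X| <= #|` Y| + n ->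
    (X `|` B') \in indep M.
  by move=> /(_ #|` X| fset0); apply; rewrite ?fsub0set ?fset0U ?leq_addl.
elim=> [|n IHn] Y sYX YM leX.
  by have -> : X = Y by apply/esym/eqP; rewrite eqEfcard sYX; rewrite addn0 in leX.
have [->//|neYX] := eqVneq X Y.
have ltYX : #|` Y| < #|` X|.
  by rewrite ltnNge; apply: contra neYX => le; rewrite eq_sym eqEfcard sYX.
have XB0 : X `&` B = fset0.
  by apply/eqP; rewrite -fsubset0 -XC fsetIS.
have [|y [yXB yYB yM]] := indep_augment YM XBM.
  rewrite [ltnRHS]cardfsU XB0 cardfs0 subn0.
  by rewrite (leq_ltn_trans (_ : _ <= #|` Y| + #|` B'|)) ?cardfsU ?leq_subr //; lia.
have yX : y \in X.
  move: yXB; rewrite in_fsetU => /orP[//|yB]; move: yYB; rewrite in_fsetU negb_or => /andP[_].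
  have yB'M : (y |` B') \in indep M.
    by apply: indepS yM _; rewrite fsetUS // fsubsetUr.
  have syC : y |` B' `<=` C by rewrite fsubUset fsub1set (fsubsetP sBC).
  by rewrite -(maxB' _ yB'M syC (fsubsetUr _ _)) fset1U1.
apply: (IHn (y |` Y)); first by rewrite fsubUset fsub1set yX.
  by rewrite -fsetUA.
move: yYB; rewrite in_fsetU negb_or cardfsU1 => /andP[-> _].
by rewrite add1n addSnnS.
Qed.

(** A transversal of [V] avoiding both [X] and [B] is a transversal of [V] without [B] avoiding [X].
    Deleted elements stay as vertices outside the ground set. *)
Lemma gammoid_minor M N : gammoid M -> is_minor N M -> gammoid N.
Proof.
move=> [D [T repM]] [C [sCM sNM NP]]; have copM := copresented_of_represents repM.
have [sMV _ _] := repM; have [B bB] := basis_exists M C; have [BM sBC _] := bB.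
set V := vertices D in sMV copM; set K := V `\` T in copM; set Nb := (fun u w => _) in copM.
have sNV : ground N `<=` V `\` B.
  apply/fsubsetP=> x /(fsubsetP sNM); rewrite !in_fsetD => /andP[xC xM].
  by rewrite (fsubsetP sMV) // andbT; apply: contra xC; apply: (fsubsetP sBC).
suff copN : copresented N (V `\` B) K Nb.
  by have [D' [T' [repN _]]] := represents_of_copresented sNV copN; exists D', T'.
move=> X; rewrite NP; have sXM : X `<=` ground N -> X `&` C = fset0 /\ X `<=` ground M.
  move=> sXN; split; last exact: fsubset_trans (fsubset_trans sXN sNM) (fsubsetDl _ _).
  apply/eqP; rewrite -fsubset0; apply/fsubsetP=> x; rewrite in_fsetI => /andP[xX xC].
  by move/fsubsetP: sNM => /(_ _ (fsubsetP sXN _ xX)); rewrite in_fsetD xC.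
split=> -[sXN]; have [XC sXM'] := sXM sXN.
  move=> [B' [bB' XB'M]]; split=> //.
  have /copM[_ [t [tinj tN]]] := contract_basis bB' bB XC XB'M.
  exists t; split=> // i iK; have [tV tXB tNb] := tN i iK; move: tXB.
  by rewrite in_fsetU negb_or => /andP[tX tB]; split=> //; rewrite in_fsetD tB.
move=> [t [tinj tN]]; split=> //; exists B; split=> //; apply/copM; split.
  by rewrite fsubUset sXM' (indep_sub BM).
exists t; split=> // i iK; have [] := tN i iK; rewrite in_fsetD => /andP[tB tV] tX tNb.
by split=> //; rewrite in_fsetU negb_or tX.
Qed.

Lemma isomorphic_copresented (I : choiceType) M N V V' (K : {fset I}) Nb (f : U -> U) :
  copresented N V K Nb -> {in V' &, injective f} -> f @` V' = V ->
  ground M `<=` V' -> f @` ground M = ground N ->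
  (forall X, X `<=` ground M -> (X \in indep M <-> f @` X \in indep N)) ->
  copresented M V' K (fun i x => Nb i (f x)).
Proof.
move=> copN finj fV sMV fM isoM X.
have fX : X `<=` ground M -> f @` X `<=` ground N.
  by rewrite -fM => /fsubsetP sX;
    apply/fsubsetP=> _ /imfsetP[x /= /sX xM ->]; apply/imfsetP; exists x.
split=> [XM|[sXM]]; first have sXM := indep_sub XM.
  split=> //; apply/(copresents_transport _ _ finj fV (fsubset_trans sXM sMV)).
  by have /copN[] := (isoM X sXM).1 XM.
move=> /(copresents_transport _ _ finj fV (fsubset_trans sXM sMV)) copX.
by apply/isoM=> //; apply/copN; split=> //; apply: fX.
Qed.

Lemma strict_gammoid_isomorphic M N : strict_gammoid N -> isomorphic M N -> strict_gammoid M.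
Proof.
move=> [D [T [repN DN]]] [f [finj fM isoM]].
have copN := copresented_of_represents repN; rewrite DN in copN.
have copM := isomorphic_copresented copN finj fM (fsubset_refl _) fM isoM.
by have [D' [T' rep']] := represents_of_copresented (fsubset_refl _) copM; exists D', T'.
Qed.

Lemma fresh_fset (infU : infinite_universe U) (A : {fset U}) n :
  exists F : {fset U}, #|` F| = n /\ [disjoint F & A]%fset.
Proof.
elim: n => [|n [F [cF FA]]]; first by exists fset0; rewrite cardfs0 fdisjoint0X.
have [x] := infU (A `|` F); rewrite in_fsetU negb_or => /andP[xA xF].
by exists (x |` F); rewrite cardfsU1 xF cF fdisjointU1X xA.
Qed.

(** The isomorphism only relates ground sets, and the other vertices of the representation of [N]
    may collide with [ground M]. They are replaced by fresh ones before the presentation is pulled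
    back. *)
Lemma gammoid_isomorphic (infU : infinite_universe U) M N :
  gammoid N -> isomorphic M N -> gammoid M.
Proof.
move=> [D [T repN]] [f [finj fM isoM]]; have copN := copresented_of_represents repN.
have [sNV _ _] := repN; set V := vertices D in sNV copN.
pose W := V `\` ground N; have [F [cF FM]] := fresh_fset infU (ground M) #|` W|.
(* [h] extends [f] by matching the enumerations of [F] and [W], which have equal length. *)
pose h x := if x \in ground M then f x else nth x (W : seq U) (index x (F : seq U)).
have hM x : x \in ground M -> h x = f x by rewrite /h => ->.
have FnM x : x \in F -> x \notin ground M by move=> xF; apply: (fdisjointP FM).
have ltF x : x \in F -> index x (F : seq U) < size (W : seq U).
  by move=> xF; rewrite -[size _]cF index_mem.
have hF x : x \in F -> h x = nth x (W : seq U) (index x (F : seq U)) /\ h x \in W.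
  by move=> xF; rewrite /h (negPf (FnM x xF)); split=> //; apply: mem_nth; apply: ltF.
have fN x : x \in ground M -> f x \in ground N.
  by move=> xM; rewrite -fM; apply/imfsetP; exists x.
have hinj : {in ground M `|` F &, injective h}.
  have neq x y : x \in ground M -> y \in F -> h x <> h y.
    move=> xM yF; rewrite hM // => e; have [_] := hF y yF.
    by rewrite -e in_fsetD fN.
  move=> x y; rewrite !in_fsetU => /orP[xM|xF] /orP[yM|yF] e.
  - by apply: finj => //; rewrite -!hM.
  - by case: (neq x y).
  - by case: (neq y x).
  have [ex _] := hF x xF; have [ey _] := hF y yF; move: e.
  rewrite ex ey (set_nth_default x y) ?ltF // => /eqP.
  rewrite nth_uniq ?ltF ?fset_uniq // => /eqP eI.
  by rewrite -(nth_index x xF) eI nth_index.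
have hV : h @` (ground M `|` F) = V.
  apply/fsetP=> y; apply/imfsetP/idP => /= [[x]|yV].
    rewrite in_fsetU => /orP[xM ->|/hF[_ hW] ->].
      by rewrite hM // (fsubsetP sNV) // fN.
    by move: hW; rewrite in_fsetD => /andP[].
  have [yN|yN] := boolP (y \in ground N).
    move: yN; rewrite -fM => /imfsetP[x /= xM ->]; exists x; rewrite ?in_fsetU ?xM //.
    by rewrite hM.
  have yW : y \in W by rewrite in_fsetD yN.
  have ltW : index y (W : seq U) < size (F : seq U) by rewrite [size _]cF index_mem.
  pose x := nth y (F : seq U) (index y (W : seq U)).
  have xF : x \in F by apply: mem_nth.
  exists x; first by rewrite in_fsetU xF orbT.
  have [-> _] := hF x xF; rewrite index_uniq ?fset_uniq //.
  by rewrite (set_nth_default y) ?nth_index ?index_mem.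
have hMN : h @` ground M = ground N.
  by rewrite -fM; apply: eq_in_imfset => // x xM; rewrite hM.
have isoM' X : X `<=` ground M -> (X \in indep M <-> h @` X \in indep N).
  move=> sXM; rewrite isoM //; suff -> : f @` X = h @` X by [].
  by apply: eq_in_imfset => // x xX; rewrite hM // (fsubsetP sXM).
have copM := isomorphic_copresented copN hinj hV (fsubsetUl _ _) hMN isoM'.
by have [D' [T' [repM _]]] := represents_of_copresented (fsubsetUl _ _) copM; exists D', T'.
Qed.

End Gammoids.

(** * Strict extensions of gammoids *)

Lemma exists_intermediate_set (T : finType) (A : {set T}) n :
  #|A| <= n <= #|T| -> exists B : {set T}, A \subset B /\ #|B| = n.
Proof.
move=> /andP[leAn lenT]; have [k] := ubnP (n - #|A|); elim: k A leAn => // k IHk A leAn.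
rewrite ltnS => lek; have [eAn|neAn] := eqVneq #|A| n; first by exists A.
have [x xA] : exists x, x \notin A.
  apply/existsP; rewrite -negb_forall; apply/negP=> /forallP allA.
  have AT : A = setT by apply/setP=> x; rewrite inE allA.
  by rewrite AT cardsT in leAn neAn; rewrite eqn_leq leAn lenT in neAn.
have cA : #|x |: A| = #|A|.+1 by rewrite cardsU1 xA.
have [||B [sAB cB]] := IHk (x |: A); rewrite ?cA; try by lia.
by exists B; split=> //; apply: subset_trans sAB; apply: subsetUr.
Qed.

Section Indexing.
Local Open Scope fset_scope.
Variables (U : choiceType) (m : nat) (e : 'I_m -> U).
Hypothesis einj : injective e.
Implicit Types (X Y : {fset U}) (A B : {set 'I_m}).

Definition index_preim X : {set 'I_m} := [set i | e i \in X].
Definition index_im A : {fset U} := [fset e i | i in A].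

Lemma mem_index_im A i : (e i \in index_im A) = (i \in A).
Proof. by rewrite /index_im mem_imfset. Qed.

Lemma index_imP A x : reflect (exists2 i, i \in A & x = e i) (x \in index_im A).
Proof. exact: imfsetP. Qed.

Lemma card_index_im A : #|` index_im A| = #|A|.
Proof. by rewrite card_imfset //= -cardE. Qed.

Lemma index_preimK X : X `<=` index_im setT -> index_im (index_preim X) = X.
Proof.
move=> /fsubsetP sX; apply/fsetP=> x; apply/index_imP/idP => [[i]|xX].
  by rewrite inE => eX ->.
by have /index_imP[i _ xi] := sX x xX; exists i; rewrite // inE -xi.
Qed.

Lemma index_imK A : index_preim (index_im A) = A.
Proof. by apply/setP=> i; rewrite inE mem_index_im. Qed.

Lemma card_index_preim X : X `<=` index_im setT -> #|index_preim X| = #|` X|.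
Proof. by move=> sX; rewrite -card_index_im index_preimK. Qed.

Lemma index_preimS X Y : X `<=` Y -> index_preim X \subset index_preim Y.
Proof. by move=> /fsubsetP sXY; apply/subsetP=> i; rewrite !inE => /sXY. Qed.

Lemma index_preim_subset X A : X `<=` index_im A -> index_preim X \subset A.
Proof. by move/index_preimS; rewrite index_imK. Qed.

Lemma index_im_subset A X : A \subset index_preim X -> index_im A `<=` X.
Proof. by move=> /subsetP sA; apply/fsubsetP=> _ /index_imP[i /sA + ->]; rewrite inE. Qed.

Lemma index_imS A B : A \subset B -> index_im A `<=` index_im B.
Proof. by move=> sAB; apply: index_im_subset; rewrite index_imK. Qed.

Lemma index_preimU1 x X i : x = e i -> index_preim (x |` X) = i |: index_preim X.
Proof. by move=> ->; apply/setP=> j; rewrite inE in_fset1U (inj_eq einj) !inE. Qed.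

Definition index_inv (i0 : 'I_m) x := odflt i0 [pick i | e i == x].

Lemma index_invK i0 i : index_inv i0 (e i) = i.
Proof.
by rewrite /index_inv; case: pickP => [j /eqP/einj|/(_ i)] //=; rewrite eqxx.
Qed.

(** This carries routings over to Hall's condition on indices. Indices of elements that are neither
    vertices nor in [T] are isolated non-targets, which a matching sends to themselves. *)
Lemma hall_indep_routing D (T X : {fset U}) :
  vertices D `<=` index_im setT -> X `<=` vertices D ->
  (exists R, is_routing D X T R) <->
  hall_indep (fun i => [set j | (j == i) || ((e i, e j) \in arcs D)])
             [set i | e i \notin T] (index_preim X).
Proof.
move=> /fsubsetP sDV sXD; have sXV := fsubsetP sXD.
have arcV u w : (u, w) \in arcs D -> u \in vertices D /\ w \in vertices D.
  by move=> /(fsubsetP (arcs_sub D)); rewrite in_fsetM => /andP[].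
rewrite copresents_routing // hall_matching; split=> -[s [sinj sN]].
  pose t i := if e i \in vertices D then index_inv i (s (e i)) else i.
  have tE i : e i \notin T -> e i \in vertices D -> e (t i) = s (e i).
    move=> iT iD; have [|sD _ _] := sN (e i); first by rewrite in_fsetD iT.
    by have /index_imP[j _ sj] := sDV _ sD; rewrite /t iD sj index_invK.
  have tD i : e i \notin T -> (e (t i) \in vertices D) = (e i \in vertices D).
    move=> iT; have [iD|iD] := boolP (e i \in vertices D).
      by rewrite tE //; have [|sD _ _] := sN (e i); rewrite ?in_fsetD ?iT.
    by rewrite /t (negPf iD) (negPf iD).
  exists t; split=> [i j|i]; rewrite !inE.
    move=> iT jT tij; have eD : (e i \in vertices D) = (e j \in vertices D).
      by rewrite -tD // tij tD.
    have [iD|iD] := boolP (e i \in vertices D).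
      apply/einj/sinj; rewrite ?in_fsetD ?iT ?jT -?eD //.
      by rewrite -!tE -?eD // tij.
    by move: tij; rewrite /t -eD (negPf iD).
  move=> iT; have [iD|iD] := boolP (e i \in vertices D); last first.
    by rewrite /t (negPf iD) eqxx; split=> //; apply: contra iD; apply: sXV.
  rewrite tE //; have [|_ sX sA] := sN (e i); first by rewrite in_fsetD iT.
  split=> //; case: sA => [si|->]; last by rewrite orbT.
  by rewrite /t iD si index_invK eqxx.
pose t u := if [pick i | e i == u] is Some i then e (s i) else u.
have tE i : t (e i) = e (s i).
  by rewrite /t; case: pickP => [j /eqP/einj ->|/(_ i)] //; rewrite eqxx.
exists t; split=> [u w|u]; rewrite !in_fsetD.
  move=> /andP[uT uD] /andP[wT wD]; have /index_imP[i _ ui] := sDV u uD.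
  have /index_imP[j _ wj] := sDV w wD; rewrite ui wj !tE in uT wT * => /einj/sinj.
  by rewrite !inE uT wT => /(_ isT isT) ->.
move=> /andP[uT uD]; have /index_imP[i _ ui] := sDV u uD; rewrite ui tE in uT uD *.
have [|sNb sX] := sN i; first by rewrite inE.
move: sNb sX; rewrite !inE => /orP sNb sX; case: sNb => [/eqP si|sA].
  by rewrite si in sX *; split=> //; left.
by split=> //; [have [] := arcV _ _ sA|right].
Qed.

Section Kernel.
Variables (L A : {set 'I_m}) (Nb : 'I_m -> {set 'I_m}).
Hypothesis diag : {in L, forall u, u \in Nb u}.

(** Augmentation is inherited from the linear representation over the rationals, and heredity from
    the description by matchings. *)
Lemma hall_indep_matroid_axioms :
  matroid_axioms (index_im A)
    [fset X in fpowerset (index_im A) | hall_indep Nb L (index_preim X)].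
Proof.
have memI X : (X \in [fset X in fpowerset (index_im A) | hall_indep Nb L (index_preim X)]) =
    (X `<=` index_im A) && hall_indep Nb L (index_preim X).
  by rewrite in_fset inE /= fpowersetE.
have sA X : X `<=` index_im A -> X `<=` index_im setT.
  by move=> sX; apply: fsubset_trans sX (index_imS (subsetT A)).
apply/matroid_axiomsP; split=> [X||X Y|X Y]; rewrite !memI ?fsub0set.
- by case/andP.
- have -> : index_preim fset0 = set0 by apply/setP=> i; rewrite !inE.
  apply/hall_indepP=> S sSL; rewrite cards0 set0U.
  exact: leq_cards (sub_nbs diag sSL).
- move=> /andP[sXA /hall_matching[s [sinj sN]]] sYX; rewrite (fsubset_trans sYX sXA) /=.
  apply/hall_matching; exists s; split=> // u uL; have [sNb sX] := sN u uL.
  by split=> //; apply: contra sX; apply/subsetP/index_preimS.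
move=> /andP[sXA hX] /andP[sYA hY]; rewrite -!card_index_preim ?sA //.
have [r [H [_ repH]]] := nbs_represented_rat diag.
move=> /(hall_indep_augment repH hX hY)[i]; rewrite !inE => /andP[iX iY] hiX.
exists (e i); rewrite memI fsubUset fsub1set sXA (fsubsetP sYA) //=.
by rewrite (index_preimU1 _ (erefl (e i))).
Qed.

Definition index_matroid := Matroid hall_indep_matroid_axioms.

Lemma mem_index_matroid X : (X \in indep index_matroid) =
  (X `<=` index_im A) && hall_indep Nb L (index_preim X).
Proof. by rewrite in_fset inE /= fpowersetE. Qed.

(* Outside [A] only loops without neighbours are left. *)
Lemma index_matroid_strict :
  ~: L \subset A -> {in L :\: A, forall u, Nb u = [set u]} -> strict_gammoid index_matroid.
Proof.
move=> sLA isolated.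
suff copM : copresented index_matroid (index_im A) [fset i in L :&: A]
    (fun i x => x \in index_im (Nb i)).
  by have [D [T []]] := represents_of_copresented (fsubset_refl _) copM; exists D, T.
have memK i : (i \in [fset i in L :&: A]) = (i \in L) && (i \in A).
  by rewrite in_fset /= inE.
move=> X; rewrite mem_index_matroid; split=> [/andP[sXA /hall_matching[s [sinj sN]]]|].
  split=> //; exists (e \o s); split=> [i j|i]; rewrite !memK.
    by move=> /andP[iL _] /andP[jL _] /= /einj/sinj->.
  move=> /andP[iL iA]; have [sNb sX] := sN i iL; rewrite /= !mem_index_im sNb.
  split=> //; last by move: sX; rewrite inE.
  (* If [s i] were outside [A], it would be an isolated non-target fixed by [s]. Injectivity would
     then give [s i = i], which is in [A]. *)
  apply: contraT => sA.
  have sL : s i \in L by apply: contraR sA => sL; rewrite (subsetP sLA) // inE.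
  have [ssN _] := sN (s i) sL; rewrite isolated ?inE ?sA // in ssN.
  by move/eqP: ssN => /(sinj _ _ sL iL) si; rewrite si iA in sA.
move=> [sXA [t [tinj tN]]]; rewrite sXA; apply/hall_matching.
exists (fun i => if i \in A then index_inv i (t i) else i).
have tE i : i \in L -> i \in A ->
    [/\ e (index_inv i (t i)) = t i, index_inv i (t i) \in A & index_inv i (t i) \in Nb i].
  move=> iL iA; have [|tA _ tNb] := tN i; first by rewrite memK iL.
  by have /index_imP[j jA tj] := tA; rewrite tj index_invK jA -mem_index_im -tj.
split=> [i j iL jL|i iL].
  case: ifP => iA; case: ifP => jA.
  - have [ei _ _] := tE i iL iA; have [ej _ _] := tE j jL jA => eij.
    by apply: tinj; rewrite ?memK ?iL ?jL // -ei eij.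
  - by have [_ + _] := tE i iL iA => + eij; rewrite eij jA.
  - by have [_ + _] := tE j jL jA => + eij; rewrite -eij iA.
  by [].
case: ifP => iA; last first.
  by split; [apply: diag|apply: contraFN iA; apply/subsetP/index_preim_subset].
have [ei _ iNb] := tE i iL iA; split=> //; rewrite inE ei.
by have [|_ ->] := tN i; rewrite ?memK ?iL.
Qed.

End Kernel.
End Indexing.

Section StrictExtension.
Local Open Scope fset_scope.
Variable U : choiceType.
Hypothesis infU : infinite_universe U.

Lemma gammoid_strict_extension (G : matroid U) : gammoid G ->
  exists N, [/\ strict_gammoid N, is_extension N G &
    #|` ground N| = (rk G (ground G) ^ 2 * #|` ground G| + rk G (ground G) + #|` ground G|)%N].
Proof.
move=> [D [T [sGV sTV repG]]]; set r := rk _ _; set n := #|` ground G|.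
(* The fresh elements guarantee room to pad the ground set to the exact size required. *)
have [F [cF FD]] := fresh_fset infU (vertices D) (r ^ 2 * n + r + n).
pose V := vertices D `|` F; pose e := tnth (in_tuple (V : seq U)).
have einj : injective e by apply/tuple_uniqP; apply: fset_uniq.
have eV : V `<=` index_im e setT.
  apply/fsubsetP=> x xV; have /tnthP[i xi] : x \in in_tuple (V : seq U) by [].
  by apply/index_imP; exists i.
have DV := fsubset_trans (fsubsetUl _ _ : vertices D `<=` V) eV.
pose L : {set 'I_(size V)} := [set i | e i \notin T].
pose Nb (i : 'I_(size V)) : {set 'I_(size V)} := [set j | (j == i) || ((e i, e j) \in arcs D)].
have diag : {in L, forall u, u \in Nb u} by move=> u _; rewrite inE eqxx.
pose E := index_preim e (ground G).
have cE : #|E| = n by rewrite card_index_preim // (fsubset_trans sGV).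
have indepG X : X `<=` ground G -> (X \in indep G) = hall_indep Nb L (index_preim e X).
  move=> sXG; have sXD := fsubset_trans sXG sGV; apply/idP/idP.
    by move=> /repG[_ /(hall_indep_routing einj _ DV sXD)].
  by move=> hX; apply/repG; split=> //; apply/(hall_indep_routing einj _ DV sXD).
have [L' [Nb' [diag' ind' act' [B [sBE hB cB]]]]] := kernel E diag.
(* The number of new targets is at most [#|B|], and [B] indexes an independent subset of the ground
   set of [G]. *)
have leBr : #|B| <= r.
  rewrite -(card_index_im einj) /r /rk; have sBG := index_im_subset sBE.
  have BG : index_im e B \in indep G by rewrite indepG // index_imK.
  by apply: (leq_bigmax_seq (F := fun Y : {fset U} => #|` Y|) (index_im e B) BG).
(* The ground set, the targets and the active vertices contribute at most [n], [r] and [r ^ 2 * n].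
   Every vertex outside [A0] is an isolated non-target, so [A0] and its supersets give strict
   gammoids. *)
pose A0 := E :|: ~: L' :|: (active Nb' L' :\: E).
have leA0 : #|A0| <= r ^ 2 * n + r + n.
  have leact : (#|active Nb' L' :\: E| <= r ^ 2 * n)%N.
    apply: leq_trans act' _; rewrite cE mulnC -mulnn.
    by rewrite !leq_mul // (leq_trans cB leBr).
  have := cardsU (E :|: ~: L') (active Nb' L' :\: E); have := cardsU E (~: L').
  rewrite -/A0 cE; have := leq_trans cB leBr; rank_lia.
have [|A [sA0 cA]] := @exists_intermediate_set _ A0 (r ^ 2 * n + r + n).
  rewrite leA0 card_ord /V -[size _]/(#|` vertices D `|` F|) cardfsU.
  have -> : vertices D `&` F = fset0 by apply/eqP; rewrite fsetIC fsetI_eq0.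
  by rewrite cardfs0 subn0 cF leq_addl.
move: sA0; rewrite !subUset => /andP[/andP[sEA sLA] sactA].
exists (index_matroid einj A diag'); split.
- apply: index_matroid_strict => // u; rewrite inE => /andP[uA uL]; apply/eqP.
  have uE : u \notin E by apply: contra uA; apply: (subsetP sEA).
  by apply: contraR uA => act; apply: (subsetP sactA); rewrite in_setD uE /= inE uL.
- split=> [|X].
    by rewrite /= -(index_preimK (fsubset_trans sGV DV)); apply: index_imS.
  rewrite mem_index_matroid; split=> [XG|[/andP[_ hX] sXG]]; last first.
    by rewrite indepG // -ind' // index_preimS.
  have sXG := indep_sub XG; rewrite sXG; split=> //; apply/andP; split.
    rewrite -(index_preimK (fsubset_trans sXG (fsubset_trans sGV DV))).
    by apply/index_imS/(subset_trans _ sEA)/index_preimS.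
  by rewrite ind' ?index_preimS // -indepG.
- by rewrite card_index_im.
Qed.

End StrictExtension.

Theorem lemma2p4 (U : choiceType) (infU : infinite_universe U)
    (t : tableau U) (ht : decisive t) :
  gammoid (goal t) <-> exists M : matroid U, tG t M /\ teq t (goal t) M.
Proof.
have [[vG vM vX veq] dec] := ht; split=> [gamG|[M [GM eqM]]]; last first.
  (* The class of the goal contains the gammoid [M], so by validity it consists of gammoids. *)
  have [domG _] := teq_dom eqM; have [gam|nogam] := veq _ domG.
    exact/gam/teq_refl.
  by case: (nogam M eqM); apply: vG.
(* For a gammoid goal the other two alternatives contradict validity: minors and isomorphic copies
   of gammoids are gammoids, and the strict extension of the prescribed size would be isomorphic to
   a member of [tM]. *)
case: dec => [//|[M [N [XM minN isoMN]]]|ext].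
  by case: (vX M XM); apply: gammoid_isomorphic isoMN => //; apply: gammoid_minor minN.
have [N [strN extN cN]] := gammoid_strict_extension infU gamG.
have [M [tMM isoMN]] := ext N extN cN.
by case: (vM M tMM); apply: strict_gammoid_isomorphic strN isoMN.
Qed.
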